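(* Let $K$ be an algebraically closed field of characteristic zero. For $n\in\mathbb{N}$ let $\Lambda=\Lambda_n$ be the $K$-algebra given by the quiver with two vertices $1,2$, one arrow $a\colon 1\to 2$ and one loop $b\colon 2\to 2$, subject to the relations $b^n=0$ and $b^2a=0$. Then $\Lambda$ has the dense orbit property (is DO) for all $n$.
   Context: Paths are composed as maps, so $b^2a$ means first $a$, then $b$ twice. For a dimension vector $\mathbf{d}=(d_1,d_2)$ of non-negative integers, the module variety is $$\mathrm{mod}(\Lambda,\mathbf{d})=\{(A,B)\in\mathrm{Mat}_{d_2\times d_1}(K)\times\mathrm{Mat}_{d_2\times d_2}(K)\mid B^n=0,\ B^2A=0\},$$ an affine variety (set of $K$-points) on which $\mathrm{GL}(\mathbf{d})=\mathrm{GL}(d_1,K)\times\mathrm{GL}(d_2,K)$ acts by base change, $(g_1,g_2)\cdot(A,B)=(g_2Ag_1^{-1},\,g_2Bg_2^{-1})$. An algebra is said to have the dense orbit property (is DO) if, for every dimension vector $\mathbf{d}$, each irreducible component of its module variety of dimension vector $\mathbf{d}$ contains a dense $\mathrm{GL}(\mathbf{d})$-orbit. *)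

(* Defs.v *)
From HB Require Import structures.
From mathcomp Require Import all_boot all_algebra.
From mathcomp Require Import boolp classical_sets topology_structure.
From mathcomp Require Import mpoly.

Set Implicit Arguments.
Unset Strict Implicit.
Unset Printing Implicit Defensive.

Import GRing.Theory.

Local Open Scope classical_set_scope.
Local Open Scope ring_scope.

Section Irreducible.
Variable T : topologicalType.
Implicit Types X Z : set T.

Definition irreducible_set Z :=
  Z !=set0 /\
  forall F G : set T, closed F -> closed G ->
    Z `<=` F `|` G -> Z `<=` F \/ Z `<=` G.

Definition irreducible_component X Z :=
  [/\ Z `<=` X, irreducible_set Z
    & forall Y, Y `<=` X -> irreducible_set Y -> Z `<=` Y -> Y = Z].

End Irreducible.

(* Representations of the quiver with one arrow a : 1 -> 2 and one loop b at 2,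
   as pairs (A, B); matrices act on column vectors, so that the path "first a,
   then b twice" acts as B ^+ 2 *m A. The topology put on this type below is
   the Zariski topology of the affine space of dimension d2 * d1 + d2 * d2, not
   a product topology. *)
Definition rep (K : fieldType) (d1 d2 : nat) : Type :=
  ('M[K]_(d2, d1) * 'M[K]_d2)%type.

HB.instance Definition _ (K : fieldType) d1 d2 := Choice.on (rep K d1 d2).

Section Zariski.
Variables (K : fieldType) (d1 d2 : nat).

Definition coords (M : rep K d1 d2) : 'I_(d2 * d1 + d2 * d2) -> K :=
  row_mx (mxvec M.1) (mxvec M.2) ord0.

Definition zeros (S : set {mpoly K[d2 * d1 + d2 * d2]}) : set (rep K d1 d2) :=
  [set M | forall p, S p -> p.@[coords M] = 0].

Definition zariski_open : set_system (rep K d1 d2) :=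
  [set U | exists S, ~` U = zeros S].

Lemma zariski_openT : zariski_open setT.
Proof.
exists [set 1]; rewrite setCT; apply/seteqP; split=> // M /(_ 1 erefl) /eqP.
by rewrite meval1 oner_eq0.
Qed.

Lemma zariski_openI : setI_closed zariski_open.
Proof.
move=> U V [S US] [T VT]; exists [set p * q | p in S & q in T].
rewrite setCI US VT; apply/seteqP; split=> M.
  by case=> HM _ [p Sp [q Tq <-]]; rewrite mevalM;
    [rewrite (HM p Sp) mul0r | rewrite (HM q Tq) mulr0].
move=> HM; have [HS|] := pselect (zeros S M); first by left.
move=> /existsNP [p /not_implyP [Sp /eqP pM0]]; right=> q Tq.
have /eqP := HM _ (ex_intro2 _ _ p Sp (ex_intro2 _ _ q Tq erefl)).
by rewrite mevalM mulf_eq0 (negbTE pM0) => /eqP.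
Qed.

Lemma zariski_open_bigcup (I : Type) (f : I -> set (rep K d1 d2)) :
  (forall i, zariski_open (f i)) -> zariski_open (\bigcup_i f i).
Proof.
move=> fo; exists [set p | exists i, forall M, ~ f i M -> p.@[coords M] = 0].
rewrite setC_bigcup; apply/seteqP; split=> M HM.
  by move=> p [i]; apply; exact: HM.
move=> i _; have [S fS] := fo i; rewrite fS => p Sp; apply: HM.
exists i => N; rewrite -[~ _]/((~` f i) N) fS; exact.
Qed.

HB.instance Definition _ := isOpenTopological.Build (rep K d1 d2)
  zariski_openT zariski_openI zariski_open_bigcup.

Lemma zariski_closedE (Z : set (rep K d1 d2)) :
  closed Z <-> exists S, Z = zeros S.
Proof.
rewrite -openC; split=> -[S ZS]; exists S; first by rewrite -ZS setCK.
by rewrite setCK.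
Qed.

End Zariski.

Definition mod_variety (K : fieldType) (n d1 d2 : nat) : set (rep K d1 d2) :=
  [set M | M.2 ^+ n = 0 /\ M.2 ^+ 2 *m M.1 = 0].

Arguments mod_variety : clear implicits.

Section Orbits.
Variables (K : fieldType) (d1 d2 : nat).

Definition base_change (g1 : 'M[K]_d1) (g2 : 'M[K]_d2) (M : rep K d1 d2) :
    rep K d1 d2 :=
  (g2 *m M.1 *m invmx g1, g2 *m M.2 *m invmx g2).

Definition GL_orbit (M : rep K d1 d2) : set (rep K d1 d2) :=
  [set N | exists g1 g2,
     [/\ g1 \in unitmx, g2 \in unitmx & N = base_change g1 g2 M]].

End Orbits.

Definition dense_orbit_property (K : fieldType) (n : nat) :=
  forall (d1 d2 : nat) (C : set (rep K d1 d2)),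
    irreducible_component (mod_variety K n d1 d2) C ->
    exists M : rep K d1 d2, GL_orbit M `<=` C /\ C `<=` closure (GL_orbit M).

(* Main.v *)
Require Import Defs.
From mathcomp Require Import all_boot all_algebra.
From mathcomp Require Import zify ring.
From mathcomp Require Import boolp classical_sets topology_structure mpoly.
Import GRing.Theory.
Local Open Scope ring_scope.

Set Implicit Arguments.
Unset Strict Implicit.
Unset Printing Implicit Defensive.

(* If the module variety is a finite union of closures of orbits, then every
   irreducible component is one of them, because orbit closures are irreducible
   (two points of an orbit lie on a rational curve inside the orbit). Such a
   finite cover is found by induction on the dimension: every representation
   (A, B) is a limit of representations (A + t A', B) which split off a summand
   from a finite list, namely one supported on at most two Jordan blocks of B.

   For fixed B let W be the image of A, d its source dimension, U = ker B^2,
   r = dim (ker B :&: im B), N the largest and p the smallest size of a Jordan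
   block of B; J_i is a block of size i, s_i spans its socle and e_i is a
   preimage of s_i under B. For generic A with image in U:
   - if d < r or d = 0, then B^(N-1) V is not contained in W + B W, and
     0 -> J_N splits off;
   - if d > r, then W meets ker B (if p = 1), or contains some w and B w (if
     p > 1), in a vector outside B^p V, and the full kernel of B^2 on J_p
     splits off;
   - if d = r > 0, then B maps W isomorphically onto ker B :&: im B, and W
     contains a vector w = e_N + s with s in ker B. If N <= p + 1, then w
     itself generates a block of size N, and <e_N> in J_N splits off; otherwise
     s generates the socle of a block J_p, and <e_N + s_p, e_p> in J_N + J_p
     splits off (without e_p if p = 1).

   All matrices below are transposed, a = A^T and b = B^T, and act on row
   vectors, to fit the row space conventions of mxalgebra. *)

(** * Jordan blocks, their socles, and homomorphisms from and to them *)

Section Jordan.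
Variable K : fieldType.

Definition jordan k : 'M[K]_k := \matrix_(i, j) (i.+1 == j)%:R.
(** The last basis vector, which spans the kernel of [jordan k]; [presoc] is its preimage one step
    up the block, and is 0 in a block of size 1. *)
Definition soc k : 'rV[K]_k := \row_j (j.+1 == k)%:R.
Definition presoc k : 'rV[K]_k := \row_j (j.+2 == k)%:R.

(** A homomorphism from [jordan k] to [b] is determined by the image v of the first basis vector,
    subject to v b^k = 0. *)
Definition jin d (b : 'M[K]_d) k (v : 'rV[K]_d) : 'M[K]_(k, d) :=
  \matrix_(i < k) (v *m b ^+ i).
(** Dually, a homomorphism from [b] to [jordan k] is determined by its last coordinate f, subject to
    b^k f = 0. *)
Definition jout d (b : 'M[K]_d) k (f : 'cV[K]_d) : 'M[K]_(d, k) :=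
  \matrix_(i, j) (b ^+ (k - j.+1) *m f) i 0.

Lemma sum_natr_eq (I : finType) (P : pred I) (i0 : I) (F : I -> K) :
  (forall i, P i = (i == i0)) -> \sum_i (P i)%:R * F i = F i0.
Proof.
move=> Pi0; rewrite (bigD1 i0) //= Pi0 eqxx mul1r big1 ?addr0 // => i /negbTE.
by rewrite Pi0 => ->; rewrite mul0r.
Qed.

Lemma sum_natr_eq0 (I : finType) (P : pred I) (F : I -> K) :
  P =1 pred0 -> \sum_i (P i)%:R * F i = 0.
Proof. by move=> P0; rewrite big1 // => i _; rewrite P0 mul0r. Qed.

Lemma jin_comm d (b : 'M[K]_d) k v :
  v *m b ^+ k = 0 -> jin b k v *m b = jordan k *m jin b k v.
Proof.
move=> vb0; apply/row_matrixP => i; rewrite !row_mul rowK -mulmxA mulmxE -exprSr.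
apply/rowP => j; rewrite [in RHS]mxE.
under eq_bigr do rewrite 2!mxE.
have [ik|ki] := ltnP i.+1 k.
  by rewrite (@sum_natr_eq _ _ (Ordinal ik)) ?mxE //; move=> l; rewrite -val_eqE /=; lia.
rewrite sum_natr_eq0; last by move=> l /=; apply/eqP; have := ltn_ord l; lia.
have -> : i.+1 = k by have := ltn_ord i; lia.
by rewrite vb0 mxE.
Qed.

Lemma soc_jin d (b : 'M[K]_d) k v : soc k.+1 *m jin b k.+1 v = v *m b ^+ k.
Proof.
apply/rowP => j; rewrite mxE; under eq_bigr do rewrite mxE.
by rewrite (@sum_natr_eq _ _ ord_max) ?mxE // => l; rewrite -val_eqE /=; lia.
Qed.

Lemma presoc_jin d (b : 'M[K]_d) k v : presoc k.+2 *m jin b k.+2 v = v *m b ^+ k.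
Proof.
apply/rowP => j; rewrite mxE; under eq_bigr do rewrite mxE.
by rewrite (@sum_natr_eq _ _ (Ordinal (ltnW (ltnSn k.+1)))) ?mxE // => l; rewrite -val_eqE /=; lia.
Qed.

Lemma jout_comm d (b : 'M[K]_d) k f :
  b ^+ k *m f = 0 -> b *m jout b k f = jout b k f *m jordan k.
Proof.
move=> bf0; apply/matrixP => i j; rewrite [in RHS]mxE.
have -> : (b *m jout b k f) i j = (b ^+ (k - j) *m f) i 0.
  rewrite -subSS subSn ?ltn_ord // exprS -mulmxE -mulmxA !mxE.
  by apply: eq_bigr => l _; rewrite !mxE.
under eq_bigr do rewrite mulrC [jordan _ _ _]mxE.
case: j => -[|j] jk.
  by rewrite subn0 bf0 sum_natr_eq0 ?mxE.
by rewrite (@sum_natr_eq _ _ (Ordinal (ltnW jk))) ?mxE // => l; rewrite -val_eqE /=; lia.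
Qed.

(** Column j involves b^(k-j-1), so a b^2 = 0 leaves only the last two columns. *)
Lemma mul_jout d (b : 'M[K]_d) k f m (a : 'M[K]_(m, d)) :
  a *m b ^+ 2 = 0 ->
  a *m jout b k f = (a *m f) *m soc k + (a *m b *m f) *m presoc k.
Proof.
move=> ab0; apply/matrixP => i j.
have -> : (a *m jout b k f) i j = (a *m b ^+ (k - j.+1) *m f) i 0.
  by rewrite -mulmxA !mxE; apply: eq_bigr => l _; rewrite !mxE.
rewrite [in RHS]mxE ![((_ *m _) *m _) _ j]mxE !big_ord1 ![_ 0 j]mxE.
case E: (k - j.+1)%N => [|[|l]].
- have [-> ->] : (j.+1 == k) /\ (j.+2 == k) = false by have := ltn_ord j; lia.
  by rewrite expr0 mulmx1 mulr0 mulr1 addr0.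
- have [-> ->] : (j.+1 == k) = false /\ (j.+2 == k) by have := ltn_ord j; lia.
  by rewrite expr1 mulr0 mulr1 add0r.
- rewrite (exprD b 2 l : b ^+ l.+2 = _) -mulmxE [a *m _]mulmxA ab0 !mul0mx mxE.
  have -> : (j.+1 == k) = false by apply/eqP; lia.
  have -> : (j.+2 == k) = false by apply/eqP; lia.
  by rewrite !mulr0 addr0.
Qed.

Lemma ker_jordan k (u : 'rV[K]_k) :
  u *m jordan k = 0 -> exists x, u = x *: soc k.
Proof.
case: k u => [|k] u uJ; first by exists 0; rewrite [u]thinmx0 [soc _]thinmx0 scaler0.
exists (u 0 ord_max); apply/rowP => j; rewrite !mxE.
have [jk|jk] := eqVneq j.+1 k.+1.
  by rewrite mulr1; congr (u _ _); apply: val_inj => /=; lia.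
rewrite mulr0.
have jk1 : (j.+1 < k.+1)%N by have := ltn_ord j; lia.
move/rowP/(_ (Ordinal jk1)): uJ; rewrite !mxE => <-.
under eq_bigr do rewrite mulrC mxE.
by rewrite (@sum_natr_eq _ _ j) // => l; rewrite -val_eqE /=; lia.
Qed.

End Jordan.

(** * Splitting off a direct summand *)

Section Mx.
Variable K : fieldType.

(** Rank normal form of X1 gives Y and Z with Y X1 Z = 1. Then Q = det (Y X(t) Z) along the line is
    a polynomial with value 1 at t = 1, and the rank is at least k wherever it does not vanish. *)
Lemma generic_rank m n k (X0 X1 : 'M[K]_(m, n)) :
  (k <= \rank X1)%N ->
  exists2 Q : {poly K}, Q != 0 &
    forall t, Q.[t] != 0 -> (k <= \rank (X0 + t *: (X1 - X0))%R)%N.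
Proof.
move=> kX1.
pose Y : 'M[K]_(k, m) := pid_mx k *m invmx (col_ebase X1).
pose Z : 'M[K]_(n, k) := invmx (row_ebase X1) *m pid_mx k.
have km := leq_trans kX1 (rank_leq_row X1).
have kn := leq_trans kX1 (rank_leq_col X1).
have YXZ : Y *m X1 *m Z = 1%:M.
  rewrite -{1}(mulmx_ebase X1) /Y /Z !mulmxA mulmxKV ?col_ebase_unit //.
  rewrite -[_ *m row_ebase X1 *m _]mulmxA mulmxV ?row_ebase_unit // mulmx1.
  rewrite !mul_pid_mx -pid_mx_1; congr pid_mx; lia.
pose Qm := map_mx polyC (Y *m X0 *m Z) + 'X *: map_mx polyC (Y *m (X1 - X0) *m Z).
have Qt t : (\det Qm).[t] = \det (Y *m (X0 + t *: (X1 - X0)) *m Z).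
  rewrite -[_.[t]]/(horner_eval t (\det Qm)) -det_map_mx; congr (\det _).
  apply/matrixP => i j; rewrite mulmxDr mulmxDl -scalemxAr -scalemxAl.
  rewrite /Qm; move: (Y *m X0 *m Z) (Y *m (X1 - X0) *m Z) => P R.
  by rewrite !mxE /= /horner_eval !hornerE.
exists (\det Qm) => [|t].
  apply: contra_eq_neq (Qt 1) => ->.
  by rewrite horner0 scale1r addrC subrK YXZ det1 eq_sym oner_neq0.
rewrite Qt -unitfE => /mxrank_unit rk; rewrite -[X in (X <= _)%N]rk.
exact: leq_trans (mxrankM_maxl _ _) (mxrankM_maxr _ _).
Qed.

Lemma sub_row_free m n k (T : 'M[K]_(m, n)) : (k <= \rank T)%N ->
  exists2 D : 'M[K]_(k, n), row_free D & (D <= T)%MS.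
Proof.
move=> kT; exists (pid_mx k *m row_base T); last first.
  by rewrite (submx_trans (submxMl _ _)) // eq_row_base.
by rewrite /row_free mxrankMfree ?row_base_free // rank_pid_mx.
Qed.

Lemma row_freeP0 m n (A : 'M[K]_(m, n)) :
  reflect (forall u : 'rV_m, u *m A = 0 -> u = 0) (row_free A).
Proof.
apply: (iffP idP) => [fA u uA|A0]; first by apply: (row_free_inj fA); rewrite mul0mx.
rewrite -kermx_eq0; apply/eqP/row_matrixP => i; rewrite row0; apply: A0.
by rewrite -row_mul mulmx_ker row0.
Qed.

Lemma submxN_functional m n (A : 'M[K]_(m, n)) (u : 'rV_n) :
  ~~ (u <= A)%MS -> exists2 f : 'cV[K]_n, A *m f = 0 & u *m f = 1%:M.
Proof.
rewrite submxE => /eqP uA0.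
have [j ujN0] : exists j, (u *m cokermx A) 0 j != 0.
  apply/existsP; rewrite -negb_forall; apply: contra_notN uA0 => /forallP uA.
  by apply/rowP => j; rewrite (eqP (uA j)) mxE.
have colM k (B : 'M[K]_(k, n)) : col j (B *m cokermx A) = B *m col j (cokermx A).
  by rewrite !colE mulmxA.
exists (((u *m cokermx A) 0 j)^-1 *: col j (cokermx A)).
  by rewrite -scalemxAr -colM mulmx_coker col0 scaler0.
rewrite -scalemxAr -colM [col _ _]mx11_scalar [col _ _ 0 0]mxE.
by rewrite scale_scalar_mx mulVf.
Qed.

(** If every relation between the rows of A also killed y, the two matrices would have the same left
    kernel, hence the same rank. *)
Lemma ltn_rank_row_mx m n (A : 'M[K]_(m, n)) (y : 'cV_m) :
  (\rank A < \rank (row_mx A y))%N ->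
  exists2 c : 'rV_m, c *m A = 0 & c *m y != 0.
Proof.
move=> rA; have [ky0|] := eqVneq (kermx A *m y) 0.
  have : (kermx A <= kermx (row_mx A y))%MS.
    by apply/sub_kermxP; rewrite mul_mx_row mulmx_ker ky0 row_mx0.
  move/mxrankS; rewrite !mxrank_ker.
  by have := rank_leq_row (row_mx A y); move: rA; lia.
move=> kyN0; have [i iN0] : exists i, row i (kermx A *m y) != 0.
  apply/existsP; rewrite -negb_forall; apply: contra kyN0 => /forallP ky.
  by apply/eqP/row_matrixP => i; rewrite row0 (eqP (ky i)).
exists (row i (kermx A)); first by rewrite -row_mul mulmx_ker row0.
by rewrite -row_mul.
Qed.

Lemma row_free_functional m n (A : 'M[K]_(m, n)) (y : 'cV_m) :
  row_free A -> exists f : 'cV_n, A *m f = y.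
Proof. by case/row_freeP => B AB; exists (B *m y); rewrite mulmxA AB mul1mx. Qed.

(** Biproduct data for row vectors: i and j are the inclusions, p and q the projections. *)
Record dsum k l d (i : 'M[K]_(k, d)) (p : 'M[K]_(d, k))
    (j : 'M[K]_(l, d)) (q : 'M[K]_(d, l)) : Prop := Dsum {
  dsum11 : i *m p = 1%:M; dsum12 : i *m q = 0;
  dsum21 : j *m p = 0; dsum22 : j *m q = 1%:M;
  dsumE : p *m i + q *m j = 1%:M }.

Lemma dsum_exists k d (i : 'M[K]_(k, d)) (p : 'M[K]_(d, k)) :
  i *m p = 1%:M -> exists (j : 'M[K]_(d - k, d)) (q : 'M[K]_(d, d - k)), dsum i p j q.
Proof.
move=> ip.
have rp : \rank p = k.
  apply/eqP; rewrite eqn_leq rank_leq_col -[X in (X <= _)%N](mxrank1 K) -ip.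
  exact: mxrankM_maxr.
have [|j fj jp] := @sub_row_free _ _ (d - k) (kermx p).
  by rewrite mxrank_ker rp.
have jp0 : j *m p = 0 by apply/sub_kermxP.
(* The complementary idempotent maps into ker p, the row space of j, so it factors as q j. *)
have : (1%:M - p *m i <= j)%MS.
  suff kj : (kermx p <= j)%MS.
    apply: submx_trans kj; apply/sub_kermxP.
    by rewrite mulmxBl mul1mx -mulmxA ip mulmx1 subrr.
  by rewrite -(geq_leqif (mxrank_leqif_sup jp)) mxrank_ker rp (eqP fj).
case/submxP => q Eq; exists j, q.
have iq : i *m q = 0.
  apply: (row_free_inj fj); rewrite mul0mx -mulmxA -Eq mulmxBr mulmx1.
  by rewrite mulmxA ip mul1mx subrr.
have jq : j *m q = 1%:M.
  apply: (row_free_inj fj); rewrite mul1mx -mulmxA -Eq mulmxBr mulmx1.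
  by rewrite mulmxA jp0 mul0mx subr0.
by split=> //; rewrite -Eq addrC subrK.
Qed.

(** Homomorphisms from the model to (a, b) and back, whose composite need only be an automorphism;
    [splits_summand] normalises it to the identity. *)
Definition splits k1 k2 (aE : 'M[K]_(k1, k2)) (bE : 'M[K]_k2)
    d1 d2 (a : 'M[K]_(d1, d2)) (b : 'M[K]_d2) : Prop :=
  exists i1 p1 i2 p2,
    [/\ i1 *m a = aE *m i2, a *m p2 = p1 *m aE,
        i2 *m b = bE *m i2 & b *m p2 = p2 *m bE] /\
    i1 *m p1 \in unitmx /\ i2 *m p2 \in unitmx.

Definition summand k1 k2 (aE : 'M[K]_(k1, k2)) (bE : 'M[K]_k2)
    l1 l2 (a' : 'M[K]_(l1, l2)) (b' : 'M[K]_l2)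
    d1 d2 (a : 'M[K]_(d1, d2)) (b : 'M[K]_d2) : Prop :=
  exists i1 p1 j1 q1 i2 p2 j2 q2,
    [/\ dsum i1 p1 j1 q1, dsum i2 p2 j2 q2,
        a = p1 *m aE *m i2 + q1 *m a' *m j2
      & b = p2 *m bE *m i2 + q2 *m b' *m j2].

Lemma commute_invmx k1 k2 (x : 'M[K]_(k1, k2)) g1 g2 :
  g1 \in unitmx -> g2 \in unitmx -> x *m g2 = g1 *m x ->
  x *m invmx g2 = invmx g1 *m x.
Proof.
move=> u1 u2 xg; apply: (can_inj (mulKmx u1)).
by rewrite mulKVmx // mulmxA -xg mulmxK.
Qed.

(** Dividing the projection by the composite, an automorphism of the model, gives a retraction of
    representations; its kernel is the complement. *)
Lemma splits_summand k1 k2 (aE : 'M[K]_(k1, k2)) (bE : 'M[K]_k2)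
    d1 d2 (a : 'M[K]_(d1, d2)) (b : 'M[K]_d2) :
  splits aE bE a b ->
  exists (a' : 'M_(d1 - k1, d2 - k2)) b', summand aE bE a' b' a b.
Proof.
case=> i1 [p1] [i2] [p2] [[ia ap ib bp] [u1 u2]].
pose r1 := p1 *m invmx (i1 *m p1); pose r2 := p2 *m invmx (i2 *m p2).
have ar : a *m r2 = r1 *m aE.
  rewrite mulmxA ap -!mulmxA; congr (_ *m _); apply: commute_invmx => //.
  by rewrite mulmxA -ia -mulmxA ap mulmxA.
have br : b *m r2 = r2 *m bE.
  rewrite mulmxA bp -!mulmxA; congr (_ *m _); apply: commute_invmx => //.
  by rewrite mulmxA -ib -mulmxA bp mulmxA.
have [|j1 [q1 D1]] := @dsum_exists _ _ i1 r1; first by rewrite mulmxA mulmxV.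
have [|j2 [q2 D2]] := @dsum_exists _ _ i2 r2; first by rewrite mulmxA mulmxV.
clearbody r1 r2.
have dec m (x : 'M[K]_(m, d2)) : x = x *m r2 *m i2 + x *m q2 *m j2.
  by rewrite -!mulmxA -mulmxDr (dsumE D2) mulmx1.
exists (j1 *m a *m q2), (j2 *m b *m q2).
exists i1, r1, j1, q1, i2, r2, j2, q2; split=> //.
- rewrite {1}[a]dec ar; congr (_ + _ *m _).
  rewrite -{1}[a]mul1mx -(dsumE D1) mulmxDl -[r1 *m i1 *m a]mulmxA ia mulmxDl.
  by rewrite -!mulmxA (dsum12 D2) !mulmx0 add0r.
- rewrite {1}[b]dec br; congr (_ + _ *m _).
  rewrite -{1}[b]mul1mx -(dsumE D2) mulmxDl -[r2 *m i2 *m b]mulmxA ib mulmxDl.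
  by rewrite -!mulmxA (dsum12 D2) !mulmx0 add0r.
Qed.

(** The kernel of G is stable under the nilpotent J, so if nonzero it would meet ker J. *)
Lemma commuting_unitmx k (J G : 'M[K]_k) n : J ^+ n = 0 -> J *m G = G *m J ->
  (forall u : 'rV_k, u *m J = 0 -> u *m G = 0 -> u = 0) -> G \in unitmx.
Proof.
move=> Jn JG inj; rewrite -row_free_unit; apply/row_freeP0 => u uG.
have JGX m : J ^+ m *m G = G *m J ^+ m.
  elim: m => [|m IH]; first by rewrite mulmx1 mul1mx.
  by rewrite exprS -mulmxE -mulmxA IH mulmxA JG mulmxA.
suff H m : u *m J ^+ m = 0 -> u = 0 by apply: (H n); rewrite Jn mulmx0.
elim: m => [|m IH]; first by rewrite mulmx1.
rewrite exprSr -mulmxE mulmxA => uJ; apply/IH/inj => //.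
by rewrite -mulmxA JGX mulmxA uG mul0mx.
Qed.

(** Only the socle of the loop at vertex 2 has to be tested; invertibility at vertex 1 follows
    because [aE] is injective. *)
Lemma splitsI k1 k2 (aE : 'M[K]_(k1, k2)) (bE : 'M[K]_k2) n
    d1 d2 (a : 'M[K]_(d1, d2)) (b : 'M[K]_d2) i1 p1 i2 p2 :
  row_free aE -> bE ^+ n = 0 ->
  i1 *m a = aE *m i2 -> a *m p2 = p1 *m aE ->
  i2 *m b = bE *m i2 -> b *m p2 = p2 *m bE ->
  (forall u : 'rV_k2, u *m bE = 0 -> u *m i2 *m p2 = 0 -> u = 0) ->
  splits aE bE a b.
Proof.
move=> fE bE0 ia ap ib bp inj; exists i1, p1, i2, p2.
have u2 : i2 *m p2 \in unitmx.
  apply: (commuting_unitmx bE0) => [|u]; last by rewrite mulmxA; apply: inj.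
  by rewrite mulmxA -ib -mulmxA bp mulmxA.
do 2!split=> //; rewrite -row_free_unit; apply/row_freeP0 => u uG.
apply: (row_freeP0 _ fE); apply: (can_inj (mulmxK u2)); rewrite mul0mx -mulmxA.
have -> : aE *m (i2 *m p2) = i1 *m p1 *m aE by rewrite mulmxA -ia -mulmxA ap mulmxA.
by rewrite mulmxA uG mul0mx.
Qed.

End Mx.

(** * Splitting criteria for the six models *)

Section Models.
Variable K : fieldType.

Local Notation jordan := (@jordan K).
Local Notation soc := (@soc K).
Local Notation presoc := (@presoc K).

Lemma jordan_expE k m i j : (jordan k ^+ m) i j = (i + m == j)%N%:R.
Proof.
elim: m i => [|m IH] i; first by rewrite mxE addn0.
rewrite exprS mxE; under eq_bigr do rewrite IH mxE.
have [ik|ki] := ltnP i.+1 k.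
  by rewrite (@sum_natr_eq _ _ _ (Ordinal ik)) ?addSnnS // => l; rewrite -val_eqE /=; lia.
rewrite sum_natr_eq0 => [|l /=]; last by apply/eqP; have := ltn_ord l; lia.
by have -> : (i + m.+1 == j)%N = false by have := ltn_ord j; lia.
Qed.

Lemma jordan_nilp k m : (k <= m)%N -> jordan k ^+ m = 0.
Proof.
move=> km; apply/matrixP => i j; rewrite jordan_expE mxE.
by have -> : (i + m == j)%N = false by have := ltn_ord j; lia.
Qed.

Lemma block_diag_exp k l (x : 'M[K]_k) (y : 'M[K]_l) m :
  block_mx x 0 0 y ^+ m = block_mx (x ^+ m) 0 0 (y ^+ m).
Proof.
elim: m => [|m IH]; first exact: scalar_mx_block.
by rewrite !exprS IH -mulmxE mulmx_block !mulmx0 !mul0mx !addr0 !add0r.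
Qed.

Lemma row_free_soc k : row_free (soc k.+1).
Proof.
rewrite /row_free rank_rV eqb1; apply/eqP.
by move/rowP/(_ ord_max); rewrite !mxE eqxx => /eqP; rewrite oner_eq0.
Qed.

Lemma row_free_presoc k : row_free (presoc k.+2).
Proof.
rewrite /row_free rank_rV eqb1; apply/eqP.
move/rowP/(_ (Ordinal (ltnW (ltnSn k.+1)))); rewrite !mxE eqxx => /eqP.
by rewrite oner_eq0.
Qed.

Lemma presoc_jordan k : presoc k.+2 *m jordan k.+2 = soc k.+2.
Proof.
apply/rowP => j; rewrite mxE; under eq_bigr do rewrite 2!mxE.
by rewrite (@sum_natr_eq _ _ _ (Ordinal (ltnW (ltnSn k.+1)))) ?mxE /= ?eqSS 1?eq_sym.
Qed.

Lemma soc_jordan k : soc k *m jordan k = 0.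
Proof.
apply/rowP => j; rewrite mxE; under eq_bigr do rewrite 2!mxE.
rewrite big1 ?mxE // => l _; have jk := ltn_ord j.
by case: eqP => [lk|_]; rewrite ?mul0r // lk gtn_eqF ?mulr0.
Qed.

Lemma jout_soc d (b : 'M[K]_d) k (f : 'cV_d) (z : 'rV_d) :
  z *m jout b k.+1 f = 0 -> z *m f = 0.
Proof.
move/rowP/(_ ord_max) => zf; apply/rowP => j; rewrite ord1 [in RHS]mxE.
move: zf; rewrite [in RHS]mxE => <-; rewrite !mxE; apply: eq_bigr => l _.
by rewrite mxE subnn mul1mx.
Qed.

Section Split.
Variables (d1 d2 : nat) (a : 'M[K]_(d1, d2)) (b : 'M[K]_d2).

(** The socle of the block goes to v b^k, on which the last coordinate of the projection takes the
    nonzero value v b^k f. *)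
Lemma splits_jordan k k1 (aE : 'M_(k1, k.+1)) i1 p1 (v : 'rV_d2) (f : 'cV_d2) :
  row_free aE -> v *m b ^+ k.+1 = 0 -> b ^+ k.+1 *m f = 0 ->
  v *m b ^+ k *m f != 0 ->
  i1 *m a = aE *m jin b k.+1 v -> a *m jout b k.+1 f = p1 *m aE ->
  splits aE (jordan k.+1) a b.
Proof.
move=> fE vb bf vbf ia ap.
apply: (splitsI fE (jordan_nilp (leqnn k.+1)) ia ap).
- exact: jin_comm.
- exact: jout_comm.
move=> _ /ker_jordan[x ->]; rewrite -scalemxAl soc_jin => /jout_soc.
rewrite -scalemxAl => /eqP; rewrite scaler_eq0 (negbTE vbf) orbF => /eqP ->.
by rewrite scale0r.
Qed.

(** On the two-dimensional socle the composite has triangular last coordinates, since v b^k g = 0,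
    with nonzero diagonal entries v b^k f and w b^l g. *)
Lemma splits_jordan2 k l k1 (aE : 'M_(k1, k.+1 + l.+1)) i1 p1
    (v w : 'rV_d2) (f g : 'cV_d2) :
  (l <= k)%N -> row_free aE ->
  v *m b ^+ k.+1 = 0 -> w *m b ^+ l.+1 = 0 ->
  b ^+ k.+1 *m f = 0 -> b ^+ l.+1 *m g = 0 ->
  v *m b ^+ k *m f != 0 -> w *m b ^+ l *m g != 0 -> v *m b ^+ k *m g = 0 ->
  i1 *m a = aE *m col_mx (jin b k.+1 v) (jin b l.+1 w) ->
  a *m row_mx (jout b k.+1 f) (jout b l.+1 g) = p1 *m aE ->
  splits aE (block_mx (jordan k.+1) 0 0 (jordan l.+1)) a b.
Proof.
move=> lk fE vb wb bf bg vbf wbg vbg ia ap.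
apply: (splitsI (n := k.+1) fE _ ia ap).
- by rewrite block_diag_exp !jordan_nilp // block_mx0.
- by rewrite mul_col_mx mul_block_col !mul0mx addr0 add0r !jin_comm.
- by rewrite mul_mx_row mul_row_block !mulmx0 addr0 add0r !jout_comm.
move=> u; rewrite -[u]hsubmxK mul_row_block !mulmx0 addr0 add0r.
move=> /eqP; rewrite row_mx_eq0 => /andP[/eqP/ker_jordan[x ->] /eqP/ker_jordan[y ->]].
rewrite mul_row_col -!scalemxAl !soc_jin mul_mx_row => /eqP; rewrite row_mx_eq0.
move=> /andP[/eqP/jout_soc + /eqP/jout_soc]; rewrite !mulmxDl -!scalemxAl vbg.
rewrite scaler0 add0r => + /eqP; rewrite scaler_eq0 (negbTE wbg) orbF => + /eqP y0.
rewrite y0 !scale0r addr0 => /eqP; rewrite scaler_eq0 (negbTE vbf) orbF => /eqP->.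
by rewrite !scale0r row_mx0.
Qed.

Hypothesis ab : a *m b ^+ 2 = 0.

(** As f vanishes on W and on W b, the projection to the block kills W. *)
Lemma splits_model0 k (v : 'rV_d2) (f : 'cV_d2) :
  v *m b ^+ k.+1 = 0 -> b ^+ k.+1 *m f = 0 -> v *m b ^+ k *m f != 0 ->
  a *m f = 0 -> a *m b *m f = 0 ->
  splits (0 : 'M_(0, k.+1)) (jordan k.+1) a b.
Proof.
move=> vb bf vbf af abf.
apply: (splits_jordan (i1 := 0) (p1 := 0) _ vb bf vbf); first by rewrite /row_free mxrank0.
  by rewrite !mul0mx.
by rewrite mul_jout // af abf !mul0mx addr0.
Qed.

Lemma splits_model1 (c : 'rV_d1) (f : 'cV_d2) :
  c *m a *m b = 0 -> b *m f = 0 -> c *m a *m f != 0 ->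
  splits (soc 1) (jordan 1) a b.
Proof.
move=> cab bf caf.
apply: (splits_jordan (i1 := c) (p1 := a *m f) (v := c *m a) (f := f)) => //.
- exact: row_free_soc.
- by rewrite expr0 mulmx1.
- by rewrite soc_jin mulmx1.
rewrite mul_jout //; have -> : presoc 1 = 0 by apply/rowP => j; rewrite !mxE.
by rewrite mulmx0 addr0.
Qed.

Lemma splits_model2 l (c c' : 'rV_d1) (v : 'rV_d2) (f : 'cV_d2) :
  c *m a = v *m b ^+ l -> c *m a *m b = c' *m a ->
  b ^+ l.+2 *m f = 0 -> c *m a *m b *m f != 0 ->
  splits (col_mx (presoc l.+2) (soc l.+2)) (jordan l.+2) a b.
Proof.
move=> ca cab bf cabf.
have vb : v *m b ^+ l.+1 = c *m a *m b by rewrite ca exprSr -mulmxE mulmxA.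
have fE : row_free (col_mx (presoc l.+2) (soc l.+2)).
  apply/row_freeP0 => u; rewrite -[u]hsubmxK mul_row_col => u0.
  have u10 : lsubmx u = 0.
    apply: (row_freeP0 _ (row_free_soc l.+1)); rewrite -presoc_jordan mulmxA.
    move/(congr1 (mulmx^~ (jordan l.+2))): u0.
    by rewrite mul0mx mulmxDl -(mulmxA _ (soc _)) soc_jordan mulmx0 addr0.
  move: u0; rewrite u10 mul0mx add0r => u0.
  by rewrite (row_freeP0 _ (row_free_soc l.+1) _ u0) row_mx0.
apply: (splits_jordan (i1 := col_mx c c') (p1 := row_mx (a *m b *m f) (a *m f))
  (v := v) (f := f)) => //.
- by rewrite exprSr -mulmxE mulmxA vb -(mulmxA _ b) -(mulmxA c) mulmxE -expr2 ab mulmx0.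
- by rewrite vb.
- by rewrite !mul_col_mx presoc_jin soc_jin vb -cab ca.
- by rewrite mul_jout // mul_row_col addrC.
Qed.

(** As f vanishes on W, the projection to the block maps W to multiples of [presoc]. *)
Lemma splits_model3 k (c : 'rV_d1) (v : 'rV_d2) (f : 'cV_d2) :
  c *m a = v *m b ^+ k -> b ^+ k.+2 *m f = 0 -> a *m f = 0 ->
  c *m a *m b *m f != 0 ->
  splits (presoc k.+2) (jordan k.+2) a b.
Proof.
move=> ca bf af cabf.
have vb : v *m b ^+ k.+1 = c *m a *m b by rewrite ca exprSr -mulmxE mulmxA.
apply: (splits_jordan (i1 := c) (p1 := a *m b *m f) (v := v) (f := f)) => //.
- exact: row_free_presoc.
- by rewrite exprSr -mulmxE mulmxA vb -(mulmxA _ b) -(mulmxA c) mulmxE -expr2 ab mulmx0.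
- by rewrite vb.
- by rewrite presoc_jin.
- by rewrite mul_jout // af mul0mx add0r.
Qed.

(** The condition a b f = a g couples the two projections: a vector of W has the same coefficient at
    e_N in the large block and at s_p in the small one. The next lemma uses it in the same way. *)
Lemma splits_model4 k (c : 'rV_d1) (v : 'rV_d2) (f g : 'cV_d2) :
  v *m b ^+ k.+2 = 0 ->
  c *m a *m b = v *m b ^+ k.+1 -> (0 < k)%N ->
  b ^+ k.+2 *m f = 0 -> a *m f = 0 -> b *m g = 0 -> a *m b *m f = a *m g ->
  c *m a *m g != 0 ->
  splits (row_mx (presoc k.+2) (soc 1))
    (block_mx (jordan k.+2) 0 0 (jordan 1)) a b.
Proof.
move=> vb cab k0 bf af bg abf cag.
have bXg m : (0 < m)%N -> b ^+ m *m g = 0.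
  by case: m => // m _; rewrite exprSr -mulmxE -mulmxA bg mulmx0.
(* The block of size 1 is spanned by s = c a - e_N, where e_N = v b^k. *)
apply: (splits_jordan2 (i1 := c) (p1 := a *m g) (v := v)
  (w := c *m a - v *m b ^+ k) (f := f) (g := g)) => //.
- rewrite /row_free rank_rV eqb1; apply: contraTneq (row_free_presoc k).
  by move/eqP; rewrite row_mx_eq0 => /andP[/eqP -> _]; rewrite /row_free mxrank0.
- by rewrite expr1 mulmxBl cab exprSr -mulmxE mulmxA subrr.
- by rewrite -cab -!mulmxA (mulmxA a) abf mulmxA.
- by rewrite mulmx1 mulmxBl -[_ *m b ^+ k *m g]mulmxA bXg // mulmx0 subr0.
- by rewrite -mulmxA bXg // mulmx0.
- by rewrite mul_row_col presoc_jin soc_jin mulmx1 addrC subrK.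
- rewrite !mul_mx_row !mul_jout // af mul0mx add0r abf.
  have -> : presoc 1 = 0 by apply/rowP => j; rewrite !mxE.
  by rewrite mulmx0 addr0.
Qed.

Lemma splits_model5 k l (c c' : 'rV_d1) (v w : 'rV_d2) (f g : 'cV_d2) :
  v *m b ^+ k.+2 = 0 -> w *m b ^+ l.+2 = 0 ->
  c *m a *m b = v *m b ^+ k.+1 -> (l.+1 < k)%N ->
  c' *m a = w *m b ^+ l -> c' *m a *m b = c *m a - v *m b ^+ k ->
  b ^+ k.+2 *m f = 0 -> a *m f = 0 -> b ^+ l.+2 *m g = 0 -> a *m b *m f = a *m g ->
  c *m a *m g != 0 ->
  splits (block_mx (presoc k.+2) (soc l.+2) 0 (presoc l.+2))
    (block_mx (jordan k.+2) 0 0 (jordan l.+2)) a b.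
Proof.
move=> vb wb cab lk c'a c'ab bf af bg abf cag.
have bXg m : (l.+2 <= m)%N -> b ^+ m *m g = 0.
  by move=> /subnK <-; rewrite exprD -mulmxE -mulmxA bg mulmx0.
(* Here s = c a - e_N is the socle vector of the block generated by w. *)
have wbl : w *m b ^+ l.+1 = c *m a - v *m b ^+ k.
  by rewrite -c'ab c'a exprSr -mulmxE mulmxA.
have fE : row_free (block_mx (presoc k.+2) (soc l.+2) 0 (presoc l.+2)).
  apply/row_freeP0 => u; rewrite -[u]hsubmxK mul_row_block mulmx0 addr0.
  move/eqP; rewrite row_mx_eq0 => /andP[/eqP/(row_freeP0 _ (row_free_presoc k)) ->].
  by rewrite mul0mx add0r => /eqP/(row_freeP0 _ (row_free_presoc l)) ->; rewrite row_mx0.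
apply: (splits_jordan2 (i1 := col_mx c c') (p1 := row_mx (a *m g) (a *m b *m g))
  (v := v) (w := w) (f := f) (g := g)) => //.
- by rewrite ltnW // ltnW.
- by rewrite -cab -!mulmxA (mulmxA a) abf mulmxA.
- by rewrite wbl mulmxBl -[_ *m b ^+ k *m g]mulmxA bXg // mulmx0 subr0.
- by rewrite -mulmxA bXg ?mulmx0 // leqW.
- by rewrite mul_col_mx mul_block_col !presoc_jin soc_jin mul0mx add0r wbl addrC subrK c'a.
- rewrite !mul_mx_row !mul_jout // af mul0mx add0r abf.
  by rewrite mul_row_block mulmx0 addr0.
Qed.

End Split.
End Models.

(** * Generic representations *)

Section Generic.
Variable K : fieldType.

Local Notation jordan := (@jordan K).
Local Notation soc := (@soc K).
Local Notation presoc := (@presoc K).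

Record model := Model {
  mdim1 : nat; mdim2 : nat; marrow : 'M[K]_(mdim1, mdim2); mloop : 'M[K]_mdim2 }.

(* [k.+1] and [l.+1] are the block sizes N and p; [presoc] and [soc] are the
   vectors e and s. *)
Definition model_of (k l i : nat) : model :=
  match i with
  | 0 => Model (0 : 'M_(0, k.+1)) (jordan k.+1)
  | 1 => Model (soc 1) (jordan 1)
  | 2 => Model (col_mx (presoc l.+1) (soc l.+1)) (jordan l.+1)
  | 3 => Model (presoc k.+1) (jordan k.+1)
  | 4 => Model (row_mx (presoc k.+1) (soc 1)) (block_mx (jordan k.+1) 0 0 (jordan 1))
  | _ => Model (block_mx (presoc k.+1) (soc l.+1) 0 (presoc l.+1))
               (block_mx (jordan k.+1) 0 0 (jordan l.+1))
  end.

(** Genericity is tested along the line from a at t = 0 to a1 at t = 1, with b fixed. Q may vanish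
    at 0, so nothing is claimed about a itself. *)
Definition generically_splits (E : model) d1 d2 (a : 'M[K]_(d1, d2)) b : Prop :=
  exists2 a1 : 'M[K]_(d1, d2), a1 *m b ^+ 2 = 0 &
  exists2 Q : {poly K}, Q != 0 & forall t, Q.[t] != 0 ->
    splits (marrow E) (mloop E) (a + t *: (a1 - a)) b.

(** A lower bound on the rank of an affine matrix expression F is an open condition, so one point a1
    where it holds suffices. *)
Lemma generically_splitsI E d1 d2 (a : 'M[K]_(d1, d2)) b m n
    (F : 'M[K]_(d1, d2) -> 'M[K]_(m, n)) r (a1 : 'M[K]_(d1, d2)) :
  (forall x y t, F (x + t *: (y - x)) = F x + t *: (F y - F x)) ->
  a *m b ^+ 2 = 0 -> a1 *m b ^+ 2 = 0 -> (r <= \rank (F a1))%N ->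
  (forall x, x *m b ^+ 2 = 0 -> (r <= \rank (F x))%N ->
    splits (marrow E) (mloop E) x b) ->
  generically_splits E a b.
Proof.
move=> Faff ab a1b rF spl; exists a1 => //.
have [Q Q0 QP] := generic_rank (F a) rF.
exists Q => // t /QP; rewrite -Faff; apply: spl.
by rewrite mulmxDl -scalemxAl mulmxBl ab a1b subrr scaler0 addr0.
Qed.

Variables (d1 d2 : nat) (a : 'M[K]_(d1, d2)) (b : 'M[K]_d2).
Hypothesis ab : a *m b ^+ 2 = 0.
Let T := (kermx b :&: b)%MS.

Lemma sub_T m (x : 'M[K]_(m, d2)) : x *m b ^+ 2 = 0 -> (x *m b <= T)%MS.
Proof.
move=> xb; rewrite sub_capmx submxMl andbT; apply/sub_kermxP.
by rewrite -mulmxA mulmxE -expr2.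
Qed.

(** T lies in the image of b, so independent vectors of T lift through b; such lifts serve as the
    special points a1 below. *)
Lemma lift_T m : (m <= \rank T)%N ->
  exists x : 'M[K]_(m, d2), [/\ row_free (x *m b), (x *m b <= T)%MS & x *m b ^+ 2 = 0].
Proof.
move=> /sub_row_free[D fD DT]; move: (DT); rewrite sub_capmx => /andP[/sub_kermxP Db].
by case/submxP => x Dx; exists x; rewrite expr2 -mulmxE mulmxA -Dx.
Qed.

(** Here and below, [kermx b <= b ^+ l.+1] says that all nilpotent Jordan blocks of b have size at
    least l + 2. *)
Lemma ker_sub_T l m (y : 'M[K]_(m, d2)) :
  (kermx b <= b ^+ l.+1)%MS -> y *m b = 0 -> (y <= T)%MS.
Proof.
move=> kl yb; have yk : (y <= kermx b)%MS by apply/sub_kermxP.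
rewrite sub_capmx yk (submx_trans yk) // (submx_trans kl) // exprSr -mulmxE.
exact: submxMl.
Qed.

(** Since u b lies in ker b, it equals v b^(l+1); then u - v b^l lies in ker b too, and is corrected
    by another element of the image of b^(l+1). *)
Lemma ker2_sub l (u : 'rV[K]_d2) :
  (kermx b <= b ^+ l.+1)%MS -> u *m b ^+ 2 = 0 -> exists v, u = v *m b ^+ l.
Proof.
move=> kl ub; have : (u *m b <= b ^+ l.+1)%MS.
  by apply: submx_trans kl; apply/sub_kermxP; rewrite -mulmxA mulmxE -expr2.
case/submxP => v Ev; have : (u - v *m b ^+ l <= b ^+ l.+1)%MS.
  apply: submx_trans kl; apply/sub_kermxP.
  by rewrite mulmxBl Ev -mulmxA mulmxE -exprSr subrr.
case/submxP => w Ew; exists (v + w *m b); rewrite mulmxDl -mulmxA mulmxE -exprS.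
by rewrite -Ew addrC subrK.
Qed.

(* [y] and [y *m b] are independent, since [b] kills [y *m b] and is injective on [y]. *)
Lemma row_free_col_mul (y : 'M[K]_(d1, d2)) :
  y *m b ^+ 2 = 0 -> row_free (y *m b) -> row_free (col_mx y (y *m b)).
Proof.
move=> yb fyb; apply/row_freeP0 => u; rewrite -[u]hsubmxK mul_row_col => e.
have u10 : lsubmx u = 0.
  apply: (row_freeP0 _ fyb); move/(congr1 (mulmx^~ b)): e.
  by rewrite mul0mx mulmxDl -!(mulmxA _ _ b) mulmxE -expr2 yb mulmx0 addr0.
move: e; rewrite u10 mul0mx add0r => /(row_freeP0 _ fyb) ->.
by rewrite row_mx0.
Qed.

Lemma T_sub_mul (y : 'M[K]_(d1, d2)) : d1 = \rank T ->
  y *m b ^+ 2 = 0 -> row_free (y *m b) -> (T <= y *m b)%MS.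
Proof.
move=> d1T yb fyb; have yT := sub_T yb.
by rewrite -(geq_leqif (mxrank_leqif_sup yT)) (eqP fyb) -d1T.
Qed.

(** The open condition is that the rows of y, of y b and s = v b^k are independent; it provides f
    with value 1 on s that vanishes on W and W b. *)
Lemma generic_model0 k (v : 'rV_d2) : b ^+ k.+1 = 0 -> v *m b ^+ k != 0 ->
  (d1 < \rank T)%N || (d1 == 0)%N -> generically_splits (model_of k 0 0) a b.
Proof.
move=> bk vb hd; have [s sE] : exists s, s = v *m b ^+ k by exists (v *m b ^+ k).
rewrite -sE in vb.
have sb : s *m b = 0 by rewrite sE -mulmxA mulmxE -exprSr bk mulmx0.
(* A complement in T of its intersection with the line of s has dimension at least [\rank T] - 1,
   which leaves room for d1 vectors. *)
have [D fD DT] : exists2 D : 'M[K]_(d1, d2), row_free D & (D <= T :\: s)%MS.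
  case/orP: hd => [d1T|/eqP d10].
    apply: sub_row_free; have := mxrank_cap_compl T s.
    by have := mxrankS (capmxSr T s); rewrite rank_rV vb; lia.
  by exists 0; rewrite ?sub0mx // /row_free mxrank0 d10.
have := submx_trans DT (diffmxSl _ _); rewrite sub_capmx => /andP[/sub_kermxP Db].
case/submxP => x Dx; have xb : x *m b ^+ 2 = 0 by rewrite expr2 -mulmxE mulmxA -Dx.
pose F (y : 'M[K]_(d1, d2)) := col_mx (col_mx y (y *m b)) s.
have rF : row_free (F x).
  apply/row_freeP0 => u; rewrite -[u]hsubmxK -[lsubmx u]hsubmxK !mul_row_col -Dx.
  move: (lsubmx (lsubmx u)) (rsubmx (lsubmx u)) (rsubmx u) => u1 u2 u3 uF.
  have u10 : u1 = 0.
    apply: (row_freeP0 _ fD); move/(congr1 (mulmx^~ b)): uF.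
    by rewrite mul0mx !mulmxDl -!mulmxA sb Db !mulmx0 !addr0 -Dx.
  have uDs : u2 *m D = - (u3 *m s).
    by apply/eqP; rewrite -addr_eq0; move: uF; rewrite u10 mul0mx add0r => ->.
  have u20 : u2 = 0.
    apply: (row_freeP0 _ fD); apply/eqP; rewrite -submx0 -(capmx_diff T s).
    by rewrite sub_capmx (submx_trans (submxMl _ _) DT) uDs eqmx_opp submxMl.
  have u30 : u3 = 0.
    have fs : row_free s by rewrite /row_free rank_rV vb.
    apply: (row_freeP0 _ fs).
    by apply: oppr_inj; rewrite -uDs u20 mul0mx oppr0.
  by rewrite u10 u20 u30 !row_mx0.
apply: (generically_splitsI (F := F) (a1 := x) (r := d1 + d1 + 1)) => //.
- move=> y z t; rewrite /F !(opp_col_mx, add_col_mx, scale_col_mx).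
  by rewrite subrr scaler0 addr0 mulmxDl -scalemxAl mulmxBl.
- by rewrite (eqP rF).
move=> y yb ry; have {}ry : row_free (F y) by rewrite /row_free eqn_leq rank_leq_row.
have [f] := row_free_functional (col_mx (col_mx 0 0) 1%:M : 'cV_(d1 + d1 + 1)) ry.
rewrite !mul_col_mx => /eq_col_mx[/eq_col_mx[yf ybf] sf].
apply: (splits_model0 yb (v := v) (f := f)); rewrite ?bk ?mulmx0 ?mul0mx //.
by rewrite -sE sf oner_neq0.
Qed.

(** As y b has rank at most [\rank T], a larger rank of F y forces a vector c y of W in ker b on
    which f does not vanish. *)
Lemma generic_model1 (f : 'cV_d2) (s : 'rV_d2) :
  b *m f = 0 -> s *m b = 0 -> s *m f = 1%:M -> (\rank T < d1)%N ->
  generically_splits (model_of 0 0 1) a b.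
Proof.
move=> bf sb sf Td1; have [x [fx xT xb]] := lift_T (leqnn (\rank T)).
pose F (y : 'M[K]_(d1, d2)) := row_mx (y *m b) (y *m f).
(* [z] pads the [\rank T] + 1 rows of [x'] with zero rows, up to d1 rows. *)
pose z : 'M[K]_(d1, \rank T + 1) := pid_mx (\rank T).+1.
have fz : row_full z by rewrite /row_full rank_pid_mx ?addn1.
pose x' := col_mx x s.
apply: (generically_splitsI (F := F) (a1 := z *m x') (r := (\rank T).+1)) => //.
- move=> y y' t; rewrite /F !(opp_row_mx, add_row_mx, scale_row_mx).
  by rewrite !mulmxDl -!scalemxAl !mulmxBl.
- by rewrite -mulmxA mul_col_mx xb expr2 -mulmxE (mulmxA s) sb mul0mx col_mx0 mulmx0.
- rewrite /F -!mulmxA -mul_mx_row (eqmxMfull _ fz) /x' !mul_col_mx sb sf.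
  suff /eqP-> : row_free (row_mx (col_mx (x *m b) 0) (col_mx (x *m f) 1%:M)) by rewrite addn1.
  apply/row_freeP0 => u; rewrite -[u]hsubmxK mul_mx_row !mul_row_col mulmx0 addr0 mulmx1.
  move/eqP; rewrite row_mx_eq0 => /andP[/eqP/(row_freeP0 _ fx) ->].
  by rewrite mul0mx add0r => /eqP ->; rewrite row_mx0.
move=> y yb ry.
have [|c cyb cyf] := @ltn_rank_row_mx _ _ _ (y *m b) (y *m f).
  by apply: leq_trans ry; rewrite ltnS mxrankS ?sub_T.
by apply: (splits_model1 yb (c := c) (f := f)); rewrite -?mulmxA.
Qed.

(** A relation c1 y b + c2 y = 0 with c1 y b f nonzero puts both w = c1 y and w b into W. It exists
    once the rank of F y exceeds the largest possible dimension of W + W b. *)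
Lemma generic_model2 l (f : 'cV_d2) (s : 'rV_d2) :
  (kermx b <= b ^+ l.+1)%MS ->
  b ^+ l.+2 *m f = 0 -> s *m b = 0 -> s *m f = 1%:M -> (\rank T < d1)%N ->
  generically_splits (model_of 0 l.+1 2) a b.
Proof.
move=> kl bf sb sf Td1; have [x [fx xT xb]] := lift_T (leqnn (\rank T)).
pose F (y : 'M[K]_(d1, d2)) := row_mx (col_mx (y *m b) y) (col_mx (y *m b *m f) 0).
pose z : 'M[K]_(d1, \rank T + 1) := pid_mx (\rank T).+1.
have fz : row_full z by rewrite /row_full rank_pid_mx ?addn1.
have /row_fullP[z' z'z] := fz.
pose x' := col_mx x s.
apply: (generically_splitsI (F := F) (a1 := z *m x') (r := (\rank T + \rank T).+1)) => //.
- move=> y y' t; rewrite /F !(opp_row_mx, add_row_mx, scale_row_mx).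
  rewrite !(opp_col_mx, add_col_mx, scale_col_mx).
  by rewrite subrr scaler0 addr0 !mulmxDl -!scalemxAl !mulmxBl.
- by rewrite -mulmxA mul_col_mx xb expr2 -mulmxE (mulmxA s) sb mul0mx col_mx0 mulmx0.
- pose G := row_mx (col_mx (x *m b) x') (col_mx (x *m b *m f) 0).
  have GF : (G <= F (z *m x'))%MS.
    apply/submxP; exists (block_mx (row_mx 1%:M 0 *m z') 0 0 z').
    rewrite /G mul_mx_row !mul_block_col !mul0mx !addr0 !add0r !mulmx0.
    rewrite -!(mulmxA _ z') !(mulmxA z') z'z !mul1mx !mul_col_mx sb.
    by rewrite !mul_row_col !mul1mx !mul0mx !addr0.
  apply: leq_trans (mxrankS GF); suff /eqP-> : row_free G by rewrite addnA addn1.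
  apply/row_freeP0 => u; rewrite -[u]hsubmxK -[rsubmx u]hsubmxK.
  move: (lsubmx u) (lsubmx (rsubmx u)) (rsubmx (rsubmx u)) => u1 u2 u3.
  rewrite mul_mx_row !mul_row_col mulmx0 addr0 => /eqP; rewrite row_mx_eq0.
  case/andP=> /eqP e1 /eqP e2.
  have u20 : u2 = 0.
    apply: (row_freeP0 _ fx); move/(congr1 (mulmx^~ b)): e1.
    rewrite mul0mx !mulmxDl -!(mulmxA _ _ b) sb mulmx0 addr0 mulmxE -expr2 xb.
    by rewrite mulmx0 add0r.
  move: e1; rewrite u20 mul0mx add0r => e1.
  have u30 : u3 = 0.
    move/(congr1 (mulmx^~ f)): e1; rewrite mul0mx mulmxDl -!mulmxA sf mulmx1.
    by rewrite -mulmxA in e2; rewrite e2 add0r.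
  move: e1; rewrite u30 mul0mx addr0 => /(row_freeP0 _ fx) ->.
  by rewrite !row_mx0.
move=> y yb ry.
have [|c] := @ltn_rank_row_mx _ _ _ (col_mx (y *m b) y) (col_mx (y *m b *m f) 0).
  apply: leq_trans ry; rewrite ltnS.
  (* b maps W + W b into T, with kernel inside ker b, which is contained in T. *)
  rewrite -(mxrank_mul_ker _ b) leq_add // mxrankS //.
    by rewrite mul_col_mx col_mx_sub (sub_T yb) andbT -mulmxA mulmxE -expr2 yb sub0mx.
  by rewrite (submx_trans (capmxSr _ _)) // (ker_sub_T kl) ?mulmx_ker.
rewrite -[c]hsubmxK !mul_row_col mulmx0 addr0; move: (lsubmx c) (rsubmx c) => c1 c2.
move=> e1 e2; have [|v Ev] := ker2_sub kl (u := c1 *m y); first by rewrite -mulmxA yb mulmx0.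
apply: (splits_model2 yb (c := c1) (c' := - c2) (v := v) (f := f)) => //.
- by rewrite mulNmx; apply/eqP; rewrite -addr_eq0 -mulmxA e1.
- by rewrite -!mulmxA; rewrite -!mulmxA in e2.
Qed.

(** Generically W b = T contains v b^(k+1) = c y b. The error c y - v b^k lies in ker b, hence in
    the image of b^k, and is absorbed by changing the generator v. *)
Lemma generic_model3 k (v : 'rV_d2) :
  b ^+ k.+2 = 0 -> v *m b ^+ k.+1 != 0 -> (kermx b <= b ^+ k)%MS -> d1 = \rank T ->
  generically_splits (model_of k.+1 0 3) a b.
Proof.
move=> bk vb kk d1T; have [|x [fx xT xb]] := @lift_T d1; first by rewrite d1T.
pose F (y : 'M[K]_(d1, d2)) := y *m b.
apply: (generically_splitsI (F := F) (a1 := x) (r := d1)) => //.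
- by move=> y y' t; rewrite /F mulmxDl -scalemxAl mulmxBl.
- by rewrite (eqP fx).
move=> y yb ry; have {}ry : row_free (y *m b) by rewrite /row_free eqn_leq rank_leq_row.
have [s sE] : exists s, s = v *m b ^+ k.+1 by exists (v *m b ^+ k.+1).
have sb : s *m b = 0 by rewrite sE -mulmxA mulmxE -exprSr bk mulmx0.
have Tyb := T_sub_mul d1T yb ry.
have /submxP[c Ec] : (s <= y *m b)%MS.
  apply: submx_trans Tyb; rewrite sub_capmx; apply/andP; split; first exact/sub_kermxP.
  by rewrite sE exprSr -mulmxE mulmxA submxMl.
have /submxP[w Ew] : (c *m y - v *m b ^+ k <= b ^+ k)%MS.
  apply: submx_trans kk; apply/sub_kermxP.
  by rewrite mulmxBl -mulmxA -Ec sE exprSr -mulmxE mulmxA subrr.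
have [|g _ sg] := @submxN_functional _ _ _ (0 : 'M_d2) s.
  by rewrite submx0 sE.
have [f] := row_free_functional (col_mx 0 (y *m b *m g)) (row_free_col_mul yb ry).
rewrite mul_col_mx => /eq_col_mx[yf ybf].
apply: (splits_model3 yb (c := c) (v := v + w) (f := f)) => //.
- by rewrite mulmxDl -Ew addrC subrK.
- by rewrite bk mul0mx.
- by rewrite -!(mulmxA c) ybf (mulmxA c) -Ec sg oner_neq0.
Qed.

(* The genericity condition of the last two cases says that the vector of [W]
   lifting [s] through [b] is not killed by [g]. *)
Lemma generic_two_blocks E k (v s1 : 'rV_d2) (g : 'cV_d2) :
  b ^+ k.+2 = 0 -> v *m b ^+ k.+1 != 0 ->
  s1 *m b = 0 -> s1 *m g = 1%:M -> d1 = \rank T ->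
  (forall (y : 'M_(d1, d2)) (c : 'rV_d1) (f : 'cV_d2), y *m b ^+ 2 = 0 -> (T <= y *m b)%MS ->
     c *m y *m b = v *m b ^+ k.+1 -> y *m f = 0 -> y *m b *m f = y *m g ->
     c *m y *m g != 0 -> splits (marrow E) (mloop E) y b) ->
  generically_splits E a b.
Proof.
move=> bk vb s1b s1g d1T H; have [|x [fx xT xb]] := @lift_T d1; first by rewrite d1T.
have [s sE] : exists s, s = v *m b ^+ k.+1 by exists (v *m b ^+ k.+1).
rewrite -sE in vb H.
have sb : s *m b = 0 by rewrite sE -mulmxA mulmxE -exprSr bk mulmx0.
have sT : (s <= T)%MS.
  rewrite sub_capmx; apply/andP; split; first exact/sub_kermxP.
  by rewrite sE exprSr -mulmxE mulmxA submxMl.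
have /submxP[c Ec] := submx_trans sT (T_sub_mul d1T xb fx).
have [|h _ ch] := @submxN_functional _ _ _ (0 : 'M_d1) c.
  by apply: contra vb; rewrite submx0 Ec => /eqP->; rewrite mul0mx.
(* A rank one correction by s1 in ker b leaves x b unchanged and makes c x' g equal to 1. *)
pose x' := x + h *m ((1%:M - c *m x *m g) *m s1).
have x'b : x' *m b = x *m b by rewrite mulmxDl -!mulmxA s1b !mulmx0 addr0.
have cx'g : c *m x' *m g = 1%:M.
  rewrite mulmxDr mulmxDl mulmxA ch mul1mx -[_ *m s1 *m g]mulmxA s1g mulmx1.
  by rewrite addrC subrK.
(* If y b is row free and s = c y b, then (c, -1) is up to scaling the only relation between the
   rows of y b and s, so G y is row free exactly when c y g is nonzero. F merges both conditions
   into one rank. *)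
pose G (y : 'M[K]_(d1, d2)) := row_mx (col_mx (y *m b) s) (col_mx (y *m g) 0).
pose F (y : 'M[K]_(d1, d2)) := block_mx (y *m b) 0 0 (G y).
apply: (generically_splitsI (F := F) (a1 := x') (r := d1 + (d1 + 1))) => //.
- move=> y y' t; rewrite /F /G !block_mxEh.
  rewrite !(opp_row_mx, add_row_mx, scale_row_mx, opp_col_mx, add_col_mx, scale_col_mx).
  by rewrite !subrr !scaler0 !addr0 !mulmxDl -!scalemxAl !mulmxBl.
- by rewrite expr2 -mulmxE mulmxA x'b -mulmxA mulmxE -expr2.
- suff fG : row_free (G x') by rewrite rank_diag_block_mx x'b (eqP fx) (eqP fG).
  apply/row_freeP0 => u; rewrite -[u]hsubmxK; move: (lsubmx u) (rsubmx u) => u1 u2.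
  rewrite mul_mx_row !mul_row_col mulmx0 addr0 x'b => /eqP; rewrite row_mx_eq0.
  case/andP=> /eqP e1 /eqP e2.
  have u1E : u1 = - (u2 *m c).
    apply/eqP; rewrite -addr_eq0; apply/eqP; apply: (row_freeP0 _ fx).
    by rewrite mulmxDl -mulmxA -Ec.
  move: e2; rewrite u1E mulNmx -mulmxA (mulmxA c) cx'g mulmx1 => /eqP.
  by rewrite oppr_eq0 => /eqP->; rewrite mul0mx oppr0 row_mx0.
move=> y yb; rewrite rank_diag_block_mx => ry.
have [fyb fG] : row_free (y *m b) /\ row_free (G y).
  rewrite /row_free; have := rank_leq_row (y *m b); have := rank_leq_row (G y).
  by move: ry; lia.
have Tyb := T_sub_mul d1T yb fyb; have /submxP[c' Ec'] := submx_trans sT Tyb.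
have [f] := row_free_functional (col_mx 0 (y *m g)) (row_free_col_mul yb fyb).
rewrite mul_col_mx => /eq_col_mx[yf ybf].
apply: (H y c' f) => //; first by rewrite -mulmxA.
apply: contraNneq (oner_neq0 K) => c'yg.
have := row_freeP0 _ fG (row_mx c' (- 1%:M)).
rewrite mul_mx_row !mul_row_col mulmx0 addr0 mulNmx mul1mx -Ec' subrr.
rewrite mulmxA c'yg row_mx0 => /(_ erefl)/eqP; rewrite row_mx_eq0 oppr_eq0.
by case/andP=> _ /eqP/matrixP/(_ 0 0); rewrite !mxE eqxx => /eqP.
Qed.

Lemma generic_model4 k (v s1 : 'rV_d2) (g : 'cV_d2) :
  b ^+ k.+2 = 0 -> v *m b ^+ k.+1 != 0 -> (0 < k)%N ->
  b *m g = 0 -> s1 *m b = 0 -> s1 *m g = 1%:M -> d1 = \rank T ->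
  generically_splits (model_of k.+1 0 4) a b.
Proof.
move=> bk vb k0 bg s1b s1g d1T; apply: (generic_two_blocks bk vb s1b s1g d1T).
move=> y c f yb Tyb cyb yf ybf cyg.
by apply: (splits_model4 yb _ cyb k0 _ yf bg ybf cyg); rewrite bk ?mulmx0 ?mul0mx.
Qed.

(** The difference c y - v b^k lies in ker b, hence in T = W b, which provides c'; and c' y, killed
    by b^2, lies in the image of b^l. *)
Lemma generic_model5 k l (v s1 : 'rV_d2) (g : 'cV_d2) :
  b ^+ k.+2 = 0 -> v *m b ^+ k.+1 != 0 -> (l.+1 < k)%N ->
  (kermx b <= b ^+ l.+1)%MS -> b ^+ l.+2 *m g = 0 ->
  s1 *m b = 0 -> s1 *m g = 1%:M -> d1 = \rank T ->
  generically_splits (model_of k.+1 l.+1 5) a b.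
Proof.
move=> bk vb lk kl bg s1b s1g d1T; apply: (generic_two_blocks bk vb s1b s1g d1T).
move=> y c f yb Tyb cyb yf ybf cyg.
have /submxP[c' Ec'] : (c *m y - v *m b ^+ k <= y *m b)%MS.
  apply: submx_trans Tyb; apply: (ker_sub_T kl).
  by rewrite mulmxBl cyb exprSr -mulmxE mulmxA subrr.
have [|w Ew] := ker2_sub kl (u := c' *m y); first by rewrite -mulmxA yb mulmx0.
apply: (splits_model5 yb (c := c) (c' := c') (v := v) (w := w) (f := f) (g := g)) => //.
- by rewrite bk mulmx0.
- by rewrite -addn2 exprD -mulmxE mulmxA -Ew -mulmxA yb mulmx0.
- by rewrite -mulmxA Ec'.
- by rewrite bk mul0mx.
Qed.

Lemma exists_generic_model n : (0 < d2)%N -> b ^+ n = 0 ->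
  exists k l i, [/\ k < n, l < n, i < 6 & generically_splits (model_of k l i) a b]%N.
Proof.
move=> d20 bn.
have one0 : (1%:M : 'M[K]_d2) != 0.
  by apply: contraTneq d20 => I0; rewrite -(mxrank1 K d2) I0 mxrank0.
have exN : exists N, b ^+ N == 0 by exists n; rewrite bn.
(* The nilpotency index k + 1 of b is its largest block size N. *)
case: (ex_minnP exN) => -[|k] /eqP bk mink; first by move: one0; rewrite -[1%:M]/(b ^+ 0) bk eqxx.
have kn : (k < n)%N by apply: mink; rewrite bn.
have bk0 : b ^+ k != 0 by apply: contraT; rewrite negbK => /mink; rewrite ltnn.
have [v vb] : exists v : 'rV_d2, v *m b ^+ k != 0.
  have [i biN0] : exists i, row i (b ^+ k) != 0.
    apply/existsP; rewrite -negb_forall; apply: contra bk0 => /forallP b0.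
    by apply/eqP/row_matrixP => i; rewrite row0 (eqP (b0 i)).
  by exists (delta_mx 0 i); rewrite -rowE.
(* The least such exponent, l + 1 below, is the smallest block size p. *)
have exp : exists p, ~~ (kermx b <= b ^+ p)%MS.
  exists k.+1; rewrite bk submx0; apply: contra bk0 => /eqP kb0.
  by rewrite -submx0 -kb0; apply/sub_kermxP; rewrite mulmxE -exprSr.
case: (ex_minnP exp) => -[|l] nkl minl.
  by case/negP: nkl; rewrite expr0 submx1.
have kl : (kermx b <= b ^+ l)%MS by apply: contraT => /minl; rewrite ltnn.
have lk : (l <= k)%N.
  rewrite -ltnS; apply: minl; rewrite bk submx0; apply: contra bk0 => /eqP kb0.
  by rewrite -submx0 -kb0; apply/sub_kermxP; rewrite mulmxE -exprSr.
(* s1 is the socle vector of a smallest block, and g detects it modulo the image of b^p. *)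
have /row_subPn[i] := nkl; set s1 := row i _ => /submxN_functional[g bg s1g].
have s1b : s1 *m b = 0 by rewrite -row_mul mulmx_ker row0.
have [d1T|d1T] := boolP ((d1 < \rank T) || (d1 == 0))%N.
  exists k, 0%N, 0%N; split=> //; first by apply: leq_trans kn.
  exact: generic_model0 bk vb d1T.
move: d1T; rewrite negb_or -leqNgt leq_eqVlt => /andP[/orP[/eqP d1T d10|d1T _]]; last first.
  case: l nkl minl kl lk bg => [|l] nkl minl kl lk bg.
    exists 0%N, 0%N, 1%N; split; try by apply: leq_ltn_trans kn.
    by [].
    exact: generic_model1 bg s1b s1g d1T.
  exists 0%N, l.+1, 2; split=> //; try by apply: leq_ltn_trans kn.
  exact: generic_model2 kl bg s1b s1g d1T.
case: k bk mink kn bk0 vb lk {exN} => [|k] bk mink kn bk0 vb lk.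
  (* If N = 1, then b = 0 and T = 0, contradicting d1 = [\rank T] > 0. *)
  case/eqP: d10; rewrite -d1T; apply/eqP; rewrite mxrank_eq0 -submx0.
  apply: submx_trans (capmxSr _ _) _.
  by rewrite (_ : b = 0) // -[LHS]expr1 bk.
(* Now N = k + 2 and p = l + 1, so the first case is N <= p + 1. *)
have [kl'|lk'] := leqP k l.
  exists k.+1, 0%N, 3; split=> //; first by apply: leq_trans kn.
  apply: (generic_model3 bk vb _ (esym d1T)); apply: submx_trans kl _.
  by rewrite -(subnK kl') exprD -mulmxE submxMl.
case: l nkl minl kl lk lk' bg => [|l] nkl minl kl lk lk' bg.
  exists k.+1, 0%N, 4; split=> //; first by apply: leq_trans kn.
  exact: (generic_model4 bk vb lk' bg s1b s1g (esym d1T)).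
exists k.+1, l.+1, 5; split=> //; first by apply: leq_ltn_trans kn.
exact: (generic_model5 bk vb lk' kl bg s1b s1g (esym d1T)).
Qed.

End Generic.

Local Open Scope classical_set_scope.
Local Open Scope ring_scope.

(** * Zariski closures *)

Section Zariski.
Variables (K : fieldType) (d1 d2 : nat).
Implicit Types (M N : rep K d1 d2) (S : set (rep K d1 d2)).

Local Notation R := {mpoly K[d2 * d1 + d2 * d2]}.

Lemma closure_zariskiP S M :
  closure S M <-> forall p : R, (forall N, S N -> p.@[coords N] = 0) -> p.@[coords M] = 0.
Proof.
split=> [SM p Sp|H].
  have cZ : closed (zeros [set p]) by apply/zariski_closedE; exists [set p].
  suff : zeros [set p] M by apply.
  by apply: cZ; apply: closureS SM => N SN _ ->; apply: Sp.
rewrite closureE => F [/zariski_closedE[P ->] SF] p Pp.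
by apply: H => N /SF; apply.
Qed.

Lemma coords_map (L : Type) (f : L -> K) (P1 : 'M[L]_(d2, d1)) (P2 : 'M[L]_d2) i :
  coords (map_mx f P1, map_mx f P2) i = f (row_mx (mxvec P1) (mxvec P2) 0 i).
Proof. by rewrite /coords /= -!map_mxvec -map_row_mx mxE. Qed.

Lemma coordsZ x (A : 'M[K]_(d2, d1)) (B : 'M[K]_d2) i :
  x * coords (A, B) i = coords (x *: A, x *: B) i.
Proof. by rewrite /coords /= !linearZ -scale_row_mx [RHS]mxE. Qed.

Definition gen_row : 'rV[R]_(d2 * d1 + d2 * d2) := \row_i 'X_i.
Definition gen1 : 'M[R]_(d2, d1) := vec_mx (lsubmx gen_row).
Definition gen2 : 'M[R]_d2 := vec_mx (rsubmx gen_row).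

Lemma gen_eval M :
  map_mx (meval (coords M)) gen1 = M.1 /\ map_mx (meval (coords M)) gen2 = M.2.
Proof.
have E : map_mx (meval (coords M)) gen_row = row_mx (mxvec M.1) (mxvec M.2).
  by apply/rowP => i; rewrite [LHS]mxE [gen_row _ _]mxE mevalXU.
by rewrite !map_vec_mx map_lsubmx map_rsubmx E row_mxKl row_mxKr !mxvecK.
Qed.

End Zariski.

Section PolynomialMaps.
Variables (K : fieldType) (d1 d2 : nat).
Local Notation R := {mpoly K[d2 * d1 + d2 * d2]}.
Local Notation gen1 := (@gen1 K d1 d2).
Local Notation gen2 := (@gen2 K d1 d2).
Implicit Types (M N : rep K d1 d2) (S : set (rep K d1 d2)).

Lemma eval_mx m n (v : 'I_(d2 * d1 + d2 * d2) -> K) (x : 'M[R]_(m, n)) k (y : 'M[R]_(n, k)) :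
  map_mx (meval v) (x *m y) = map_mx (meval v) x *m map_mx (meval v) y.
Proof. exact: map_mxM. Qed.

(** Polynomial maps are continuous: an equation of S' composed with the map is an equation of S. *)
Lemma closure_poly_image l1 l2 (S : set (rep K d1 d2)) (S' : set (rep K l1 l2))
    (P1 : 'M[R]_(l2, l1)) (P2 : 'M[R]_l2) M :
  (forall N, S N -> S' (map_mx (meval (coords N)) P1, map_mx (meval (coords N)) P2)) ->
  closure S M ->
  closure S' (map_mx (meval (coords M)) P1, map_mx (meval (coords M)) P2).
Proof.
move=> SS' /closure_zariskiP SM; apply/closure_zariskiP => p pS'.
pose q : R := p \mPo [tuple row_mx (mxvec P1) (mxvec P2) 0 i | i < _].
have qE N : q.@[coords N] =
    p.@[coords (map_mx (meval (coords N)) P1, map_mx (meval (coords N)) P2)].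
  rewrite comp_mpoly_meval; apply: meval_eq => i; by rewrite coords_map tnth_mktuple.
by rewrite -qE; apply: SM => N /SS'/pS'; rewrite qE.
Qed.

Lemma gen_expr n M :
  map_mx (meval (coords M)) (gen2 ^+ n) = M.2 ^+ n.
Proof.
elim: n => [|n IH]; first exact: map_mx1.
by rewrite !exprS -!mulmxE eval_mx IH (gen_eval M).2.
Qed.

(** The variety is the fibre over the closed point 0 of the polynomial map that sends (A, B) to (B^2
    A, B^n). *)
Lemma closure_mod_variety n S : S `<=` mod_variety K n d1 d2 ->
  closure S `<=` mod_variety K n d1 d2.
Proof.
move=> SV M SM.
pose Z (l1 l2 : nat) : set (rep K l1 l2) := [set N | N = (0, 0)].
have closedZ l1 l2 (N : rep K l1 l2) : closure (@Z l1 l2) N -> N = (0, 0).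
  move/closure_zariskiP => H.
  have cN i : coords N i = 0.
    rewrite -(mevalXU (coords N) i); apply: H => _ ->.
    by rewrite mevalXU /coords /= !linear0 row_mx0 mxE.
  have E0 : row_mx (mxvec N.1) (mxvec N.2) = 0.
    by apply/rowP => i; rewrite -[LHS]/(coords N i) cN mxE.
  move/eqP: E0; rewrite row_mx_eq0 => /andP[/eqP N1 /eqP N2].
  by case: N N1 N2 {H cN} => x y /= x0 y0; rewrite -[x]mxvecK -[y]mxvecK x0 y0 !linear0.
have := @closure_poly_image _ _ S (@Z d1 d2) (gen2 ^+ 2 *m gen1) (gen2 ^+ n) M _ SM.
rewrite eval_mx !gen_expr (gen_eval M).1 => H.
have /H/closedZ[e1 e2] : forall N, S N ->
    Z d1 d2 (map_mx (meval (coords N)) (gen2 ^+ 2 *m gen1),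
             map_mx (meval (coords N)) (gen2 ^+ n)).
  by move=> N /SV[e1 e2]; rewrite /Z /= eval_mx !gen_expr (gen_eval N).1 e1 e2.
by split.
Qed.

End PolynomialMaps.

(** * Rational curves and irreducibility of orbit closures *)

Section Curves.
Variable K : closedFieldType.

(* Clearing denominators: [p] evaluated along a rational curve. *)
Lemma horner_meval m (c : 'I_m -> {poly K}) (D : {poly K}) (p : {mpoly K[m]}) :
  exists P : {poly K}, exists e, forall t, D.[t] != 0 ->
    P.[t] = D.[t] ^+ e * p.@[fun i => (c i).[t] / D.[t]].
Proof.
pose good (p : {mpoly K[m]}) := exists P : {poly K}, exists e, forall t, D.[t] != 0 ->
    P.[t] = D.[t] ^+ e * p.@[fun i => (c i).[t] / D.[t]].
have goodM q r : good q -> good r -> good (q * r).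
  case=> P [e HP] [Q [f HQ]]; exists (P * Q), (e + f)%N => t Dt.
  by rewrite hornerM HP // HQ // mevalM exprD mulrACA.
have goodX i : good 'X_i.
  by exists (c i), 1%N => t Dt; rewrite mevalXU expr1 mulrC divfK.
have good1 : good 1 by exists 1, 0%N => t _; rewrite hornerC meval1 mulr1 expr0.
apply: (@mpolyind _ _ good) => [|x mm q _ _ [Q [f HQ]]].
  by exists 0, 0%N => t _; rewrite horner0 meval0 mulr0.
have [P [e HP]] : good 'X_[mm].
  rewrite mpolyXE_id; apply: big_ind => // i _.
  elim: (mm i) => [|k IH]; first by rewrite expr0.
  by rewrite exprS; apply: goodM.
exists (x *: P * D ^+ f + Q * D ^+ e), (e + f)%N => t Dt.
rewrite hornerD !hornerM hornerZ !horner_exp HP // HQ // mevalD mevalZ.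
by rewrite exprD; ring.
Qed.

Lemma exists_nonroot (p : {poly K}) : p != 0 -> exists t, p.[t] != 0.
Proof. by case/closed_nonrootP => t; rewrite rootE; exists t. Qed.

(** An equation of S restricts to a polynomial P on the line with P Q zero everywhere; as K is
    infinite, P = 0, in particular at t = 0. *)
Lemma closure_line d1 d2 (S : set (rep K d1 d2)) (A0 A1 : 'M[K]_(d2, d1)) B (Q : {poly K}) :
  Q != 0 -> (forall t, Q.[t] != 0 -> S (A0 + t *: A1, B)) -> closure S (A0, B).
Proof.
move=> Q0 QS; apply/closure_zariskiP => p pS.
pose P1 := map_mx polyC A0 + 'X *: map_mx polyC A1.
pose c i := row_mx (mxvec P1) (mxvec (map_mx polyC B)) 0 i.
have [P [e HP]] := horner_meval c 1 p.
have Pt t : P.[t] = p.@[coords (A0 + t *: A1, B)].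
  rewrite HP ?hornerC ?oner_neq0 // expr1n mul1r; apply: meval_eq => i.
  rewrite divr1 -[(c i).[t]]/(horner_eval t (c i)) -coords_map; congr (coords (_, _) i).
    by apply/matrixP => k l; rewrite !mxE /= /horner_eval !hornerE.
  by apply/matrixP => k l; rewrite !mxE /= /horner_eval hornerC.
have := Pt 0; rewrite scale0r addr0 => <-.
have [->|P0] := eqVneq P 0; first by rewrite horner0.
have /exists_nonroot[t] : P * Q != 0 by rewrite mulf_neq0.
rewrite hornerM mulf_eq0 negb_or => /andP[nz /QS/pS pt].
by case/eqP: nz; rewrite Pt.
Qed.

(** If neither F nor G contained the closure, equations p of F and q of G would be nonzero at some
    points g.M and h.M. On the line from g to h some matrices are invertible with neither p nor q
    vanishing at the orbit point, which then lies outside both F and G. *)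
Lemma irreducible_orbit_closure d1 d2 (M : rep K d1 d2) :
  irreducible_set (closure (GL_orbit M)).
Proof.
have MM : GL_orbit M M.
  by exists 1%:M, 1%:M; rewrite !unitmx1 /base_change !invmx1 !mul1mx !mulmx1; case: (M).
split=> [|F G cF cG cov]; first by exists M; apply: subset_closure.
apply: contrapT => /not_orP[nF nG].
have sep H : closed H -> ~ closure (GL_orbit M) `<=` H ->
    exists2 p, (forall N, H N -> p.@[coords N] = 0) &
      exists2 N, GL_orbit M N & p.@[coords N] != 0.
  move=> /zariski_closedE[P ->] nH; apply: contrapT => nsep; apply: nH => N MN p Pp.
  move/closure_zariskiP: MN; apply=> N' ON'; apply: contrapT => /eqP pN'.
  by apply: nsep; exists p => [N'' /(_ _ Pp)|]; last exists N'.
have [p pF [_ [g1 [g2 [u1 u2 ->]]] pN]] := sep F cF nF.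
have [q qG [_ [h1 [h2 [v1 v2 ->]]] qN]] := sep G cG nG.
pose G1 := map_mx polyC g1 + 'X *: map_mx polyC (h1 - g1).
pose G2 := map_mx polyC g2 + 'X *: map_mx polyC (h2 - g2).
(* Common denominator of the curve: writing inverses as adjugate over determinant, P1 / D and P2 / D
   are the two components of the translated M. *)
pose D := \det G1 * \det G2.
pose P1 := \det G2 *: (G2 *m map_mx polyC M.1 *m \adj G1).
pose P2 := \det G1 *: (G2 *m map_mx polyC M.2 *m \adj G2).
pose c i := row_mx (mxvec P1) (mxvec P2) 0 i.
have [P [e HP]] := horner_meval c D p.
have [Q [f HQ]] := horner_meval c D q.
pose k1 t := g1 + t *: (h1 - g1); pose k2 t := g2 + t *: (h2 - g2).
have map_curve d (g h : 'M[K]_d) t :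
    map_mx (horner_eval t) (map_mx polyC g + 'X *: map_mx polyC (h - g)) = g + t *: (h - g).
  by apply/matrixP => i j; rewrite !mxE /= /horner_eval !hornerE.
have mapG1 t : map_mx (horner_eval t) G1 = k1 t by apply: map_curve.
have mapG2 t : map_mx (horner_eval t) G2 = k2 t by apply: map_curve.
have det1 t : (\det G1).[t] = \det (k1 t).
  by rewrite -mapG1 det_map_mx.
have det2 t : (\det G2).[t] = \det (k2 t).
  by rewrite -mapG2 det_map_mx.
have cE t : D.[t] != 0 -> (fun i => (c i).[t] / D.[t]) =1 coords (base_change (k1 t) (k2 t) M).
  move=> Dt i; have [d1t d2t] : \det (k1 t) != 0 /\ \det (k2 t) != 0.
    by move: Dt; rewrite hornerM det1 det2 mulf_eq0 negb_or => /andP[].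
  have U d (g : 'M[K]_d) : \det g != 0 -> invmx g = (\det g)^-1 *: \adj g.
    by move=> dg; rewrite /invmx unitmxE unitfE dg.
  rewrite -[(c i).[t]]/(horner_eval t (c i)) -coords_map mulrC coordsZ.
  congr (coords (_, _) i).
    rewrite map_mxZ !map_mxM map_mx_adj mapG1 mapG2 /= /horner_eval det2.
    have -> : map_mx (horner_eval t) (map_mx polyC M.1) = M.1.
      by apply/matrixP => k l; rewrite !mxE /= /horner_eval hornerC.
    rewrite hornerM det1 det2 scalerA invfM -mulrA mulVf // mulr1 U //.
    by rewrite -scalemxAr.
  rewrite map_mxZ !map_mxM map_mx_adj mapG2 /= /horner_eval det1.
  have -> : map_mx (horner_eval t) (map_mx polyC M.2) = M.2.
    by apply/matrixP => k l; rewrite !mxE /= /horner_eval hornerC.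
  rewrite hornerM det1 det2 scalerA mulrC invfM mulrA mulfV // mul1r U //.
  by rewrite -scalemxAr.
have PE t : D.[t] != 0 -> P.[t] = D.[t] ^+ e * p.@[coords (base_change (k1 t) (k2 t) M)].
  by move=> Dt; rewrite HP //; congr (_ * _); apply/meval_eq/cE.
have QE t : D.[t] != 0 -> Q.[t] = D.[t] ^+ f * q.@[coords (base_change (k1 t) (k2 t) M)].
  by move=> Dt; rewrite HQ //; congr (_ * _); apply/meval_eq/cE.
have D0 : D.[0] != 0.
  by rewrite hornerM det1 det2 /k1 /k2 !scale0r !addr0 mulf_neq0 // -unitfE -unitmxE.
have D1 : D.[1] != 0.
  by rewrite hornerM det1 det2 /k1 /k2 !scale1r ![_ + (_ - _)]addrC !subrK
    mulf_neq0 // -unitfE -unitmxE.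
have P0 : P != 0.
  apply/eqP => P0; have := PE 0 D0; rewrite P0 horner0 /k1 /k2 !scale0r !addr0.
  by move/esym/eqP; rewrite mulf_eq0 expf_eq0 (negbTE D0) andbF (negbTE pN).
have Q0 : Q != 0.
  apply/eqP => Q0; have := QE 1 D1; rewrite Q0 horner0 /k1 /k2 !scale1r.
  rewrite ![_ + (_ - _)]addrC !subrK.
  by move/esym/eqP; rewrite mulf_eq0 expf_eq0 (negbTE D1) andbF (negbTE qN).
have Dn0 : D != 0 by apply: contraNneq D0 => ->; rewrite horner0.
have /exists_nonroot[t] : D * (P * Q) != 0 by rewrite mulf_neq0 // mulf_neq0.
rewrite (hornerM D) (hornerM P) mulf_eq0 negb_or mulf_eq0 negb_or.
case/and3P=> Dt Pt Qt.
have ON : GL_orbit M (base_change (k1 t) (k2 t) M).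
  exists (k1 t), (k2 t); rewrite !unitmxE !unitfE.
  by move: Dt; rewrite hornerM det1 det2 mulf_eq0 negb_or => /andP[].
have [/pF pN'|/qG qN'] := cov _ (subset_closure ON).
  by move: Pt; rewrite PE // pN' mulr0 eqxx.
by move: Qt; rewrite QE // qN' mulr0 eqxx.
Qed.

End Curves.

(** * Covering the module variety by orbit closures *)

Section Covers.
Variable K : closedFieldType.

Lemma trmx_exp d (x : 'M[K]_d) n : (x ^+ n)^T = x^T ^+ n.
Proof.
elim: n => [|n IH]; first exact: trmx1.
by rewrite exprS exprSr -!mulmxE trmx_mul IH.
Qed.

Lemma mod_variety_tr n d1 d2 (M : rep K d1 d2) :
  mod_variety K n d1 d2 M <-> M.2^T ^+ n = 0 /\ M.1^T *m M.2^T ^+ 2 = 0.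
Proof.
rewrite -!trmx_exp -trmx_mul; split=> -[e1 e2]; first by rewrite e1 e2 !trmx0.
by split; apply: trmx_inj; rewrite ?e1 ?e2 trmx0.
Qed.

Lemma GL_orbit_tr d1 d2 (M N : rep K d1 d2) h1 h2 :
  h1 \in unitmx -> h2 \in unitmx ->
  h1 *m N.1^T = M.1^T *m h2 -> h2 *m N.2^T = M.2^T *m h2 -> GL_orbit M N.
Proof.
move=> u1 u2 e1 e2; exists h1^T, h2^T; rewrite !unitmx_tr; split=> //.
case: N e1 e2 => x y /= e1 e2; congr (_, _).
  have := congr1 trmx e1; rewrite !trmx_mul !trmxK => <-.
  by rewrite mulmxK // unitmx_tr.
have := congr1 trmx e2; rewrite !trmx_mul !trmxK => <-.
by rewrite mulmxK // unitmx_tr.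
Qed.

Definition is_dsum (E : model K) l1 l2 (M' : rep K l1 l2) d1 d2 (M : rep K d1 d2) :=
  summand (marrow E) (mloop E) M'.1^T M'.2^T M.1^T M.2^T.

(** The change of basis between two decompositions; exchanging their roles gives the inverse. *)
Lemma dsum_unit k l d (i i' : 'M[K]_(k, d)) p p' (j j' : 'M[K]_(l, d)) q q' :
  dsum i p j q -> dsum i' p' j' q' -> p *m i' + q *m j' \in unitmx.
Proof.
move=> D D'; suff /mulmx1_unit[] : (p *m i' + q *m j') *m (p' *m i + q' *m j) = 1%:M by [].
rewrite mulmxDl !mulmxDr !mulmxA -!(mulmxA _ i') -!(mulmxA _ j').
rewrite (dsum11 D') (dsum12 D') (dsum21 D') (dsum22 D') !mulmx1 !mulmx0 !mul0mx.
by rewrite addr0 add0r (dsumE D).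
Qed.

Lemma dsum_comm k k2 l l2 d d2 (x : 'M[K]_(k, k2)) (y : 'M_(l, l2)) a a'
    (i i' : 'M_(k, d)) p p' (j j' : 'M_(l, d)) q q'
    (r r' : 'M_(k2, d2)) s s' (u u' : 'M_(l2, d2)) v v' :
  dsum i p j q -> dsum i' p' j' q' -> dsum r s u v -> dsum r' s' u' v' ->
  a = p *m x *m r + q *m y *m u -> a' = p' *m x *m r' + q' *m y *m u' ->
  (p *m i' + q *m j') *m a' = a *m (s *m r' + v *m u').
Proof.
move=> D1 D1' D2 D2' -> ->; rewrite !mulmxDl !mulmxDr !mulmxA.
rewrite -!(mulmxA _ i') -!(mulmxA _ j') -!(mulmxA _ r) -!(mulmxA _ u).
rewrite (dsum11 D1') (dsum12 D1') (dsum21 D1') (dsum22 D1').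
rewrite (dsum11 D2) (dsum12 D2) (dsum21 D2) (dsum22 D2).
by rewrite !mulmx1 !mulmx0 !mul0mx !addr0 !add0r.
Qed.

Lemma dsum_orbit E l1 l2 (M' : rep K l1 l2) d1 d2 (M N : rep K d1 d2) :
  is_dsum E M' M -> is_dsum E M' N -> GL_orbit M N.
Proof.
case=> i1 [p1] [j1] [q1] [i2] [p2] [j2] [q2] [D1 D2 eM1 eM2].
case=> i1' [p1'] [j1'] [q1'] [i2'] [p2'] [j2'] [q2'] [D1' D2' eN1 eN2].
apply: (GL_orbit_tr (dsum_unit D1 D1') (dsum_unit D2 D2')).
  exact: (dsum_comm D1 D1' D2 D2' eM1 eN1).
exact: (dsum_comm (x := mloop E) D2 D2' D2 D2' eM2 eN2).
Qed.

Lemma dsum_exp k l d (i : 'M[K]_(k, d)) p (j : 'M_(l, d)) q x y n :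
  dsum i p j q ->
  (p *m x *m i + q *m y *m j) ^+ n = p *m x ^+ n *m i + q *m y ^+ n *m j.
Proof.
move=> D; elim: n => [|n IH]; first by rewrite !expr0 !mulmx1 (dsumE D).
rewrite !exprS IH -!mulmxE mulmxDl !mulmxDr !mulmxA.
rewrite -!(mulmxA _ i p) -!(mulmxA _ i q) -!(mulmxA _ j p) -!(mulmxA _ j q).
rewrite (dsum11 D) (dsum12 D) (dsum21 D) (dsum22 D).
by rewrite !mulmx0 !mul0mx !mulmx1 addr0 add0r.
Qed.

Lemma dsum_eq0 k k2 l l2 d d2 (x : 'M[K]_(k, k2)) (y : 'M_(l, l2))
    (i : 'M_(k, d)) p (j : 'M_(l, d)) q (r : 'M_(k2, d2)) s (u : 'M_(l2, d2)) v :
  dsum i p j q -> dsum r s u v ->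
  (p *m x *m r + q *m y *m u = 0) <-> (x = 0 /\ y = 0).
Proof.
move=> D1 D2; split=> [e|[-> ->]]; last by rewrite !mulmx0 !mul0mx addr0.
split.
  have := congr1 (fun z => i *m z *m s) e.
  rewrite mulmx0 mul0mx mulmxDr mulmxDl !mulmxA (dsum11 D1) (dsum12 D1) mul1mx.
  by rewrite !mul0mx addr0 -mulmxA (dsum11 D2) mulmx1.
have := congr1 (fun z => j *m z *m v) e.
rewrite mulmx0 mul0mx mulmxDr mulmxDl !mulmxA (dsum21 D1) (dsum22 D1) mul1mx.
by rewrite !mul0mx add0r -mulmxA (dsum22 D2) mulmx1.
Qed.

Lemma dsum_mod_variety n E l1 l2 (M' : rep K l1 l2) d1 d2 (M : rep K d1 d2) :
  is_dsum E M' M ->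
  mod_variety K n d1 d2 M <->
  (mloop E ^+ n = 0 /\ marrow E *m mloop E ^+ 2 = 0) /\ mod_variety K n l1 l2 M'.
Proof.
case=> i1 [p1] [j1] [q1] [i2] [p2] [j2] [q2] [D1 D2 e1 e2].
rewrite !mod_variety_tr e1 e2 !dsum_exp //.
have -> : (p1 *m marrow E *m i2 + q1 *m M'.1^T *m j2) *m
    (p2 *m mloop E ^+ 2 *m i2 + q2 *m M'.2^T ^+ 2 *m j2) =
    p1 *m (marrow E *m mloop E ^+ 2) *m i2 + q1 *m (M'.1^T *m M'.2^T ^+ 2) *m j2.
  rewrite mulmxDl !mulmxDr !mulmxA.
  rewrite -!(mulmxA _ i2 p2) -!(mulmxA _ i2 q2) -!(mulmxA _ j2 p2) -!(mulmxA _ j2 q2).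
  rewrite (dsum11 D2) (dsum12 D2) (dsum21 D2) (dsum22 D2).
  by rewrite !mulmx0 !mul0mx !mulmx1 addr0 add0r.
rewrite (dsum_eq0 _ _ D2 D2) (dsum_eq0 _ _ D1 D2); tauto.
Qed.

Definition finitely_covered n d1 d2 (S : set (rep K d1 d2)) :=
  exists s : seq (rep K d1 d2), (forall N, N \in s -> mod_variety K n d1 d2 N) /\
    forall M, S M -> exists2 N, N \in s & closure (GL_orbit N) M.

Lemma finitely_coveredS n d1 d2 (S S' : set (rep K d1 d2)) :
  S `<=` S' -> finitely_covered n S' -> finitely_covered n S.
Proof. by move=> SS' [s [sV sc]]; exists s; split=> // M /SS'/sc. Qed.

Lemma finitely_coveredU n d1 d2 (S S' : set (rep K d1 d2)) :
  finitely_covered n S -> finitely_covered n S' -> finitely_covered n (S `|` S').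
Proof.
move=> [s [sV sc]] [s' [s'V s'c]]; exists (s ++ s'); split=> [N|M].
  by rewrite mem_cat => /orP[/sV|/s'V].
by case=> [/sc|/s'c] [N Ns NM]; exists N => //; rewrite mem_cat Ns ?orbT.
Qed.

Lemma finitely_covered_bigcup n d1 d2 m (S : nat -> set (rep K d1 d2)) :
  (forall i, finitely_covered n (S i)) ->
  finitely_covered n [set M | exists2 i, (i < m)%N & S i M].
Proof.
move=> Sc; elim: m => [|m IH]; first by exists [::]; split=> // M [].
apply: finitely_coveredS (finitely_coveredU IH (Sc m)) => M [i].
by rewrite ltnS leq_eqVlt => /orP[/eqP->|im] SM; [right|left; exists i].
Qed.

Lemma closed_orbit_closures d1 d2 (s : seq (rep K d1 d2)) :
  closed [set M | exists2 N, N \in s & closure (GL_orbit N) M].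
Proof.
elim: s => [|N s IH].
  suff -> : [set M | exists2 N : rep K d1 d2, N \in [::] & closure (GL_orbit N) M] = set0.
    exact: closed0.
  by apply/seteqP; split=> M // -[].
suff -> : [set M | exists2 N', N' \in N :: s & closure (GL_orbit N') M] =
    closure (GL_orbit N) `|` [set M | exists2 N, N \in s & closure (GL_orbit N) M].
  by apply: closedU => //; apply: closed_closure.
apply/seteqP; split=> M.
  by case=> N'; rewrite inE => /orP[/eqP->|Ns]; [left|right; exists N'].
by case=> [|[N' N's]] NM; [exists N|exists N']; rewrite ?inE ?eqxx ?N's ?orbT.
Qed.

(** A finite union of orbit closures is closed, so the same list serves. *)
Lemma finitely_covered_closure n d1 d2 (S : set (rep K d1 d2)) :
  finitely_covered n S -> finitely_covered n (closure S).
Proof.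
case=> s [sV sc]; exists s; split=> // M SM.
by apply: (closed_orbit_closures (s := s)); apply: closureS SM => N /sc.
Qed.

Lemma dsum_conj k l d (i : 'M[K]_(k, d)) p (j : 'M_(l, d)) q g :
  g \in unitmx -> dsum i p j q -> dsum i p (invmx g *m j) (q *m g).
Proof.
move=> ug [ip iq jp jq pi]; split=> //.
- by rewrite mulmxA iq mul0mx.
- by rewrite -mulmxA jp mulmx0.
- by rewrite mulmxA -(mulmxA _ j) jq mulmx1 mulVmx.
- by rewrite mulmxA mulmxK.
Qed.

Lemma is_dsum_orbit E l1 l2 (M' N' : rep K l1 l2) d1 d2 (M : rep K d1 d2) :
  is_dsum E M' M -> GL_orbit M' N' -> is_dsum E N' M.
Proof.
case=> i1 [p1] [j1] [q1] [i2] [p2] [j2] [q2] [D1 D2 e1 e2] [g1 [g2 [u1 u2 ->]]].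
exists i1, p1, (invmx g1^T *m j1), (q1 *m g1^T).
exists i2, p2, (invmx g2^T *m j2), (q2 *m g2^T).
have ug1 : g1^T \in unitmx by rewrite unitmx_tr.
have ug2 : g2^T \in unitmx by rewrite unitmx_tr.
split; [exact: dsum_conj D1|exact: dsum_conj D2|rewrite e1|rewrite e2];
  by congr (_ + _); rewrite /= !trmx_mul trmx_inv !mulmxA !mulmxK.
Qed.

(** Adding a fixed summand to M' in fixed decompositions is an affine map in the entries of M',
    hence compatible with closures. *)
Definition extend d1 d2 k1 k2 l1 l2 (aE : 'M[K]_(k1, k2)) (bE : 'M[K]_k2)
    i2 p1 p2 j2 q1 q2 (M' : rep K l1 l2) : rep K d1 d2 :=
  ((p1 *m aE *m i2 + q1 *m M'.1^T *m j2)^T, (p2 *m bE *m i2 + q2 *m M'.2^T *m j2)^T).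

Lemma closure_extend d1 d2 k1 k2 l1 l2 (aE : 'M[K]_(k1, k2)) (bE : 'M[K]_k2)
    i2 p1 p2 j2 q1 q2 (S : set (rep K l1 l2)) (S' : set (rep K d1 d2)) M' :
  (forall N', S N' -> S' (extend aE bE i2 p1 p2 j2 q1 q2 N')) ->
  closure S M' -> closure S' (extend aE bE i2 p1 p2 j2 q1 q2 M').
Proof.
set c := mpolyC (l2 * l1 + l2 * l2) (R := K).
pose P1 := (map_mx c (p1 *m aE *m i2) +
  map_mx c q1 *m (@gen1 K l1 l2)^T *m map_mx c j2)^T.
pose P2 := (map_mx c (p2 *m bE *m i2) +
  map_mx c q2 *m (@gen2 K l1 l2)^T *m map_mx c j2)^T.
have cK m n (N : rep K l1 l2) (x : 'M[K]_(m, n)) :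
    map_mx (meval (coords N)) (map_mx c x) = x.
  by apply/matrixP => i j; rewrite !mxE mevalC.
have PE (N : rep K l1 l2) : extend aE bE i2 p1 p2 j2 q1 q2 N =
    (map_mx (meval (coords N)) P1, map_mx (meval (coords N)) P2).
  have [g1E g2E] := gen_eval N.
  by rewrite /extend /P1 /P2 -!map_trmx !map_mxD !map_mxM -!map_trmx g1E g2E !cK.
by move=> SS'; rewrite PE; apply: closure_poly_image => N /SS'; rewrite PE.
Qed.

(** Degenerations are preserved by adding E; the choice of N is immaterial because all sums of E and
    N' lie in one orbit. *)
Lemma dsum_closure E l1 l2 (M' N' : rep K l1 l2) d1 d2 (M : rep K d1 d2) :
  is_dsum E M' M -> closure (GL_orbit N') M' ->
  (exists N : rep K d1 d2, is_dsum E N' N) /\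
  forall N, is_dsum E N' N -> closure (GL_orbit N) M.
Proof.
case=> i1 [p1] [j1] [q1] [i2] [p2] [j2] [q2] [D1 D2 e1 e2] NM.
pose ext := @extend d1 d2 _ _ l1 l2 (marrow E) (mloop E) i2 p1 p2 j2 q1 q2.
have extP X : is_dsum E X (ext X).
  exists i1, p1, j1, q1, i2, p2, j2, q2; split; rewrite ?trmxK //.
split=> [|N EN]; first by exists (ext N').
have -> : M = ext M' by rewrite /ext /extend -e1 -e2 !trmxK; case: (M).
apply: closure_extend NM => X OX.
exact: dsum_orbit (is_dsum_orbit EN OX) (extP X).
Qed.

Lemma finitely_covered_splits n E d1 d2 :
  finitely_covered n (mod_variety K n (d1 - mdim1 E) (d2 - mdim2 E)) ->
  finitely_covered n [set M : rep K d1 d2 | mod_variety K n d1 d2 M /\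
    splits (marrow E) (mloop E) M.1^T M.2^T].
Proof.
case=> s [sV sc].
have [EV|nEV] := pselect (mloop E ^+ n = 0 /\ marrow E *m mloop E ^+ 2 = 0); last first.
  exists [::]; split=> // M [MV /splits_summand[a' [b' EM]]].
  have {}EM : is_dsum E (a'^T, b'^T) M by rewrite /is_dsum !trmxK.
  by have [] := (dsum_mod_variety n EM).1 MV.
(* One sum of E and N' is chosen for each N' in the list. As the subtraction of dimensions is
   truncated, there may be none, and N' is then dropped. *)
have [s' [s'1 s'2]] : exists s' : seq (rep K d1 d2),
    (forall N, N \in s' -> exists2 N', N' \in s & is_dsum E N' N) /\
    (forall N' (N : rep K d1 d2), N' \in s -> is_dsum E N' N ->
       exists2 N0, N0 \in s' & is_dsum E N' N0).
  elim: s {sV sc} => [|N' s [s' [s'1 s'2]]]; first by exists [::].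
  have [[N EN]|nN] := pselect (exists N : rep K d1 d2, is_dsum E N' N).
    exists (N :: s'); split=> [N0|N'' N0].
      rewrite inE => /orP[/eqP->|/s'1[N'' N''s EN'']]; first by exists N'; rewrite ?mem_head.
      by exists N''; rewrite // inE N''s orbT.
    rewrite inE => /orP[/eqP->|N''s] EN0; first by exists N; rewrite ?mem_head.
    by have [N1 N1s EN1] := s'2 _ _ N''s EN0; exists N1; rewrite // inE N1s orbT.
  exists s'; split=> [N0 /s'1[N'' N''s EN'']|N'' N0].
    by exists N''; rewrite // inE N''s orbT.
  rewrite inE => /orP[/eqP->|]; last exact: s'2.
  by move=> EN0; case: nN; exists N0.
exists s'; split=> [N /s'1[N' /sV N'V EN]|M [MV /splits_summand[a' [b' EM]]]].
  exact/(dsum_mod_variety n EN).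
have {}EM : is_dsum E (a'^T, b'^T) M by rewrite /is_dsum !trmxK.
have [_ /sc[N' N's NM]] := (dsum_mod_variety n EM).1 MV.
have [[N EN] H] := dsum_closure EM NM.
by have [N0 N0s EN0] := s'2 _ _ N's EN; exists N0 => //; apply: H.
Qed.

Lemma mod_variety_finitely_covered n d1 d2 :
  finitely_covered n (mod_variety K n d1 d2).
Proof.
elim/ltn_ind: d2 d1 => -[_ d1|d2 IH d1].
  have rep0 (M : rep K d1 0) : M = (0, 0).
    by case: M => x y; rewrite [x]flatmx0 [y]flatmx0.
  exists [:: (0, 0)]; split=> [N _|M _].
    by split; apply/matrixP => -[].
  exists (0, 0); rewrite ?mem_head // [M]rep0; apply: subset_closure.
  by exists 1%:M, 1%:M; rewrite !unitmx1; split=> //; rewrite -[RHS]rep0.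
pose S k l i : set (rep K d1 d2.+1) := [set M | mod_variety K n d1 d2.+1 M /\
  splits (marrow (model_of K k l i)) (mloop (model_of K k l i)) M.1^T M.2^T].
pose U : set (rep K d1 d2.+1) := [set M | exists2 k, (k < n)%N &
  exists2 l, (l < n)%N & exists2 i, (i < 6)%N & S k l i M].
suff VU : mod_variety K n d1 d2.+1 `<=` closure U.
  apply: finitely_coveredS VU _; apply: finitely_covered_closure.
  apply: finitely_covered_bigcup => k; apply: finitely_covered_bigcup => l.
  apply: finitely_covered_bigcup => i; apply/finitely_covered_splits/IH.
  (* Each model is nonzero at vertex 2, so the complement falls under the induction hypothesis. *)
  have : (0 < mdim2 (model_of K k l i))%N by do 6?[case: i => [|i] //].
  by rewrite -subn_gt0 => i0; lia.
move=> [A B] /[dup] MV /mod_variety_tr /= [Bn AB].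
have [k [l [i [kn ln i6 [a1 a1b [Q Q0 QP]]]]]] :=
  exists_generic_model AB (ltn0Sn d2) Bn.
apply: (closure_line (A1 := a1^T - A) Q0) => t /QP spl.
exists k => //; exists l => //; exists i => //; split.
  apply/mod_variety_tr; split=> //=.
  rewrite linearD linearZ /= linearB /= trmxK mulmxDl -scalemxAl mulmxBl.
  by rewrite AB a1b subrr scaler0 addr0.
by rewrite /= linearD linearZ /= linearB /= trmxK.
Qed.

Lemma base_change_mod_variety n d1 d2 (M N : rep K d1 d2) :
  mod_variety K n d1 d2 M -> GL_orbit M N -> mod_variety K n d1 d2 N.
Proof.
move=> [Bn BA] [g1 [g2 [_ u2 ->]]].
have conjX m : (g2 *m M.2 *m invmx g2) ^+ m = g2 *m M.2 ^+ m *m invmx g2.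
  elim: m => [|m IH]; first by rewrite !expr0 mulmx1 mulmxV.
  by rewrite !exprS IH -!mulmxE !mulmxA mulmxKV.
split; rewrite /= conjX; first by rewrite Bn mulmx0 mul0mx.
move: (M.2 ^+ 2) BA => B2 BA; rewrite !mulmxA mulmxKV // -(mulmxA g2).
by rewrite BA mulmx0 mul0mx.
Qed.

End Covers.

(** * Irreducible components as orbit closures *)

Theorem theorem12 (K : closedFieldType) (char0 : [pchar K] =i pred0) (n : nat) :
  dense_orbit_property K n.
Proof.
move=> d1 d2 C [CV Cirr Cmax].
have [s [sV sc]] := mod_variety_finitely_covered K n d1 d2.
have orbV N : N \in s -> closure (GL_orbit N) `<=` mod_variety K n d1 d2.
  by move=> /sV NV; apply: closure_mod_variety => N'; apply: base_change_mod_variety.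
suff [N Ns CN] : exists2 N, N \in s & C `<=` closure (GL_orbit N).
  exists N; split=> //; rewrite -(Cmax _ (orbV _ Ns) (irreducible_orbit_closure N) CN).
  exact: subset_closure.
have {sV orbV} : C `<=` [set M | exists2 N, N \in s & closure (GL_orbit N) M].
  by move=> M /CV/sc.
(* An irreducible set covered by finitely many closed sets lies in one of them; the empty list is
   excluded because C is nonempty. *)
elim: s {sc} => [|N s IH] Cs; first by have [[M /Cs[]]] := Cirr.
have [_ Cirr2] := Cirr.
have [||M /Cs[N']|CN|/IH[N' N's CN']] :=
  Cirr2 (closure (GL_orbit N)) [set M | exists2 N, N \in s & closure (GL_orbit N) M].
- exact: closed_closure.
- exact: closed_orbit_closures.
- by rewrite inE => /orP[/eqP->|N's] MN'; [left|right; exists N'].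
- by exists N; rewrite ?mem_head.
- by exists N' => //; rewrite inE N's orbT.
Qed.
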